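(* Suppose $\mathcal T$ is a rank-one tensor ($r_j=1$ for all $j$), that $\|U_j\|_{2,\infty}\le\sqrt{\mu r_j/d_j}$ for all $j\in[m]$ (with a constant $\mu>0$), and that the tensor $\mathcal I\in\mathbb R^{d_1\times\cdots\times d_m}$ satisfies $\|P_{\mathbb T}(\mathcal I)\|_F\ge\alpha_I\,\overline d^{1/2}(d^* )^{-1/2}\|\mathcal I\|_F$ with $\alpha_I>0$. Assume the noise satisfies $\xi_i\sim N(0,\sigma^2)$. Let $\widetilde m=\max\{m,\log(n\vee\frac{\lambda_{\max}}{\sigma})/\log\overline d\}$ and $\mathbb B_{\mathrm{opt}}=\{\widetilde{\mathcal T}:\|\widetilde{\mathcal T}-\mathcal T\|_F^2\le C_0\sigma^2\,d^*\overline d\log\overline d/n\}$, with $C_0>0$ a constant. Let $\bar{\mathcal T}\in\mathcal M_{\mathbf r}$ be a rate-optimal estimator satisfying $\mathbb P(\bar{\mathcal T}\in\mathbb B_{\mathrm{opt}})\ge 1-\overline d^{-C_{\mathrm{gap}}\widetilde m}$ that is unbiased within $\mathbb B_{\mathrm{opt}}$, i.e. $\mathbb E[\bar{\mathcal T}\,\mathbb I\{\bar{\mathcal T}\in\mathbb B_{\mathrm{opt}}\}]=\mathcal T$, for some absolute constant $C_{\mathrm{gap}}>0$. Let $g_{\mathcal I}(\bar{\mathcal T})=\langle\bar{\mathcal T},\mathcal I\rangle$ be an estimator of the linear form $g_{\mathcal I}(\mathcal T)=\langle\mathcal T,\mathcal I\rangle$. If $$\varepsilon_{\mathrm{SNR}}:=C\frac{\sigma}{\lambda_{\min}}\sqrt{\Big(\frac{\|\mathcal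 I\|_{\ell_1}}{\alpha_I\|\mathcal I\|_F}\vee1\Big)\frac{\mu^{3m/2}\,\overline d\,d^*\log\overline d}{n}}\longrightarrow0$$ for some absolute constant $C>0$, then $$\mathbb E\big(g_{\mathcal I}(\bar{\mathcal T})-g_{\mathcal I}(\mathcal T)\big)^2\ge(1-\varepsilon_{\mathrm{SNR}}^2)\,\frac{\sigma^2d^*}{n}\,\|P_{\mathbb T}(\mathcal I)\|_F^2 .$$
   Context: Notation. For dimensions $d_1,\dots,d_m$ and ranks $\mathbf r=(r_1,\dots,r_m)$: $d^*=\prod_jd_j$, $d_{-j}=d^*/d_j$, $\overline d=\max_jd_j$. $\mathcal M_j(\cdot)$ is the mode-$j$ unfolding ($d_j\times d_{-j}$ matrix), $\times_j$ the mode-$j$ product, $\mathcal C\cdot(U_1,\dots,U_m)=\mathcal C\times_1U_1\cdots\times_mU_m$; $\otimes_{k\ne j}U_k$ is the Kronecker product ordered so that $\mathcal M_j(\mathcal C\cdot(U_1,\dots,U_m))=U_j\mathcal M_j(\mathcal C)(\otimes_{k\ne j}U_k)^\top$. $\mathbb O^{d\times r}$: $d\times r$ matrices with orthonormal columns; $P_U=UU^\top$, $P_U^\perp=I-P_U$; $A^\dagger$ pseudo-inverse; $\|A\|_{2,\infty}$ the largest Euclidean norm of a row. $\langle\cdot,\cdot\rangle$, $\|\cdot\|_F$, $\|\cdot\|_{\ell_1}$ are the entrywise inner product and the entrywise $\ell_2$, $\ell_1$ norms of tensors. $a\vee b=\max(a,b)$; $\mathbb I\{\cdot\}$ is the indicator.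 $\mathcal M_{\mathbf r}$ is the set of tensors in $\mathbb R^{d_1\times\cdots\times d_m}$ whose mode-$j$ unfolding has rank at most $r_j$ for every $j$. Model. $\mathcal T=\mathcal C\cdot(U_1,\dots,U_m)$ with core $\mathcal C\in\mathbb R^{r_1\times\cdots\times r_m}$, $U_j\in\mathbb O^{d_j\times r_j}$, $\mathrm{rank}(\mathcal M_j(\mathcal T))=r_j$. $\lambda_{\min}=\min_j\lambda_{r_j}(\mathcal M_j(\mathcal T))$ and $\lambda_{\max}$ are the smallest and largest non-zero singular values over all unfoldings. One observes $n$ i.i.d. pairs $(\mathcal X_i,Y_i)$, $Y_i=\langle\mathcal T,\mathcal X_i\rangle+\xi_i$, where $\mathcal X_i$ is uniform over the $d^*$ canonical basis tensors of $\mathbb R^{d_1\times\cdots\times d_m}$ and $\xi_i$ is noise independent of $\mathcal X_i$. It is assumed that $n\le\overline d^{4m}$. Tangent projection. $P_{\mathbb T}(\mathcal I)=\mathcal I\cdot(P_{U_1},\dots,P_{U_m})+\sum_{j=1}^m\mathcal C\cdot(U_1,\dots,U_{j-1},W_j,U_{j+1},\dots,U_m)$ with $W_j=P_{U_j}^\perp\mathcal M_j(\mathcal I)(\otimes_{k\ne j}U_k)\mathcal M_j(\mathcal C)^\dagger$; it is the orthogonal projection onto the tangent space $\mathbb T$ of $\mathcal M_{\mathbf r}$ at $\mathcal T$.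
   Formalization: Rate-optimality and unbiasedness are required at every rank-one, mu'-incoherent tensor (any fixed mu'>mu) in B_opt, not only at T, because the constant estimator T has zero risk; max_j d_j is at least 2; eps_SNR->0 is along a sequence and the bound holds eventually. *)

(* Defs.v *)
From HB Require Import structures.
From mathcomp Require Import all_boot all_order all_algebra.
From mathcomp Require Import all_classical all_reals all_analysis.

Set Implicit Arguments.
Unset Strict Implicit.
Unset Printing Implicit Defensive.

Import Order.TTheory GRing.Theory Num.Theory.
Import numFieldNormedType.Exports.

Local Open Scope classical_set_scope.
Local Open Scope ring_scope.

Definition multi_index (K : finType) (d : K -> nat) : finType :=
  {dffun forall k : K, 'I_(d k)}.

(* The modes other than j, and a family of dimensions restricted to them. *)
Definition other (m : nat) (j : 'I_m) : finType := {k : 'I_m | k != j}.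

Definition other_dims (m : nat) (d : 'I_m -> nat) (j : 'I_m) :
  other j -> nat := fun k => d (val k).

Definition tensor (R : realType) (m : nat) (d : 'I_m -> nat) :=
  {ffun multi_index d -> R}.

Definition rank_one (m : nat) : 'I_m -> nat := fun=> 1%N.

Definition dstar (m : nat) (d : 'I_m -> nat) : nat := (\prod_(j < m) d j)%N.

Definition dbar (m : nat) (d : 'I_m -> nat) : nat := (\max_(j < m) d j)%N.

Section Tensors.
Context (R : realType) (m : nat).
Implicit Types d r : 'I_m -> nat.

Definition inner d (A B : tensor R d) : R := \sum_w A w * B w.

Definition frob d (A : tensor R d) : R := Num.sqrt (\sum_w A w ^+ 2).

Definition l1norm d (A : tensor R d) : R := \sum_w `|A w|.

Definition basis_tensor d (w : multi_index d) : tensor R d :=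
  [ffun v => (v == w)%:R].

Definition drop_mode d (j : 'I_m) (w : multi_index d) :
    multi_index (@other_dims m d j) :=
  [ffun k : other j => w (val k)].

(* Columns are numbered by the enumeration of the multi-indices of the other
   modes. The sum has exactly one term: a multi-index is determined by its j-th
   coordinate and the remaining ones. *)
Definition unfold d (j : 'I_m) (A : tensor R d) :
    'M[R]_(d j, #|multi_index (@other_dims m d j)|) :=
  \matrix_(i, c) \sum_(w : multi_index d | (w j == i) && (drop_mode j w == enum_val c)) A w.

(* C x_1 U_1 ... x_m U_m *)
Definition tucker d r (C : tensor R r) (U : forall j, 'M[R]_(d j, r j)) :
    tensor R d :=
  [ffun w : multi_index d => \sum_(v : multi_index r)
     C v * \prod_(j < m) U j (w j) (v j)].

(* Kronecker product of the U_k, k != j, with rows and columns numbered as the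
   columns of the mode-j unfoldings. *)
Definition kron_others d r (U : forall j, 'M[R]_(d j, r j)) (j : 'I_m) :
    'M[R]_(#|multi_index (@other_dims m d j)|,
           #|multi_index (@other_dims m r j)|) :=
  \matrix_(a, b) \prod_(k : other j)
     U (val k) ((enum_val a : multi_index (@other_dims m d j)) k)
               ((enum_val b : multi_index (@other_dims m r j)) k).

(* Moore-Penrose inverse, given by the four Penrose equations, which have
   exactly one solution. (The library's pinvmx is a different partial
   inverse.) *)
Definition penrose p q (A : 'M[R]_(p, q)) (B : 'M[R]_(q, p)) : Prop :=
  [/\ A *m B *m A = A, B *m A *m B = B,
      (A *m B)^T = A *m B & (B *m A)^T = B *m A].

Definition mp_inverse p q (A : 'M[R]_(p, q)) : 'M[R]_(q, p) :=
  xget 0 [set B | penrose A B].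

Definition two_inf p q (A : 'M[R]_(p, q)) : R :=
  \big[Num.max/0]_(i < p) Num.sqrt (\sum_j A i j ^+ 2).

Definition proj p q (V : 'M[R]_(p, q)) : 'M[R]_p := V *m V^T.

Definition tangent_factor d r (C : tensor R r)
    (U : forall j, 'M[R]_(d j, r j)) (A : tensor R d) (j : 'I_m) :
    'M[R]_(d j, r j) :=
  (1%:M - proj (U j)) *m unfold j A *m kron_others U j
    *m mp_inverse (unfold j C).

Definition proj_tangent d r (C : tensor R r) (U : forall j, 'M[R]_(d j, r j))
    (A : tensor R d) : tensor R d :=
  tucker A (fun j => proj (U j)) +
  \sum_(j < m) tucker C (eqtype.dfwith U (tangent_factor C U A j)).

Definition low_rank d r (A : tensor R d) : Prop :=
  forall j, (\rank (unfold j A) <= r j)%N.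

Definition tucker_model d r (T : tensor R d) (C : tensor R r)
    (U : forall j, 'M[R]_(d j, r j)) : Prop :=
  [/\ forall j, (U j)^T *m U j = 1%:M,
      T = tucker C U
    & forall j, \rank (unfold j T) = r j].

Definition incoherent (mu : R) d r (U : forall j, 'M[R]_(d j, r j)) : Prop :=
  forall j, two_inf (U j) <= Num.sqrt (mu * (r j)%:R / (d j)%:R).

Definition incoherent_model (mu : R) d r : set (tensor R d) :=
  [set T | exists (C : tensor R r) (U : forall j, 'M[R]_(d j, r j)),
     tucker_model T C U /\ incoherent mu U].

Definition nonzero_singular_values d (T : tensor R d) : set R :=
  [set s | 0 < s /\
     exists j, eigenvalue (unfold j T *m (unfold j T)^T) (s ^+ 2)].

(* The set above is finite, so these are its minimum and maximum; when the
   mode-j unfolding has rank r_j for all j, the minimum is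
   min_j lambda_(r_j)(M_j(T)). *)
Definition lambda_min d (T : tensor R d) : R := inf (nonzero_singular_values T).

Definition lambda_max d (T : tensor R d) : R := sup (nonzero_singular_values T).

Definition mtilde d (n : nat) (sigma : R) (T : tensor R d) : R :=
  Num.max m%:R
    (ln (Num.max n%:R (lambda_max T / sigma)) / ln (dbar d)%:R).

Definition Bopt d (C0 : R) (n : nat) (sigma : R) (T : tensor R d) :
    set (tensor R d) :=
  [set A | frob (A - T) ^+ 2 <=
     C0 * (sigma ^+ 2 * (dstar d)%:R * (dbar d)%:R * ln (dbar d)%:R / n%:R)].

Definition eps_snr d (C mu alpha : R) (n : nat) (sigma : R)
    (T A : tensor R d) : R :=
  C * (sigma / lambda_min T) *
  Num.sqrt (Num.max (l1norm A / (alpha * frob A)) 1 *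
            (mu `^ (3 * m%:R / 2) * (dbar d)%:R * (dstar d)%:R *
             ln (dbar d)%:R / n%:R)).

End Tensors.

Section Sampling.
Context (R : realType) (m : nat) (d : 'I_m -> nat) (n : nat).
Context (disp : measure_display) (Omega : measurableType disp)
        (P : probability Omega R).

(* X i is the position of the i-th observed entry, i.e. the i-th design tensor
   is basis_tensor R (X i); the full product rule expresses the mutual
   independence of X_1, ..., X_n, xi_1, ..., xi_n. *)
Definition uniform_gaussian_sampling (sigma : R)
    (X : 'I_n -> Omega -> multi_index d) (xi : 'I_n -> {RV P >-> R}) : Prop :=
  [/\ forall i w, measurable (X i @^-1` [set w]),
      forall i w, P (X i @^-1` [set w]) = ((dstar d)%:R^-1)%:E,
      forall i B, measurable B ->
        distribution P (xi i) B = normal_prob 0 sigma B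
    & forall (A : 'I_n -> set (multi_index d)) (B : 'I_n -> set R),
        (forall i, measurable (B i)) ->
        P [set o | forall i, A i (X i o) /\ B i (xi i o)] =
        (\prod_(i < n) (P (X i @^-1` A i) * P (xi i @^-1` B i)))%E].

Definition response (X : 'I_n -> Omega -> multi_index d)
    (xi : 'I_n -> {RV P >-> R}) (T : tensor R d) (i : 'I_n) (o : Omega) : R :=
  inner T (basis_tensor R (X i o)) + xi i o.

Definition estimator : Type :=
  n.-tuple (multi_index d) -> n.-tuple R -> tensor R d.

(* The first argument ranges over a finite (discrete) type, so joint
   measurability is measurability in the responses for fixed positions. *)
Definition measurable_estimator (phi : estimator) : Prop :=
  forall x w, measurable_fun [set: n.-tuple R] (fun y => phi x y w).

(* The estimate computed from the sample when the true tensor is T. *)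
Definition estimate (X : 'I_n -> Omega -> multi_index d)
    (xi : 'I_n -> {RV P >-> R}) (phi : estimator) (T : tensor R d)
    (o : Omega) : tensor R d :=
  phi [tuple X i o | i < n] [tuple response X xi T i o | i < n].

Definition rate_optimal (C0 Cgap sigma : R)
    (X : 'I_n -> Omega -> multi_index d) (xi : 'I_n -> {RV P >-> R})
    (phi : estimator) (T : tensor R d) : Prop :=
  ((1 - (dbar d)%:R `^ (- (Cgap * mtilde n sigma T)))%:E <=
   P [set o | Bopt C0 n sigma T (estimate X xi phi T o)])%E.

Definition unbiased_within (C0 sigma : R)
    (X : 'I_n -> Omega -> multi_index d) (xi : 'I_n -> {RV P >-> R})
    (phi : estimator) (T : tensor R d) : Prop :=
  forall w, (\int[P]_o
     (estimate X xi phi T o w *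
      \1_[set o' | Bopt C0 n sigma T (estimate X xi phi T o')] o)%:E)%E
    = (T w)%:E.

(* Both properties concern the law under the true tensor. At a single tensor T
   they are satisfied by the constant estimate T, so they are required over a
   neighbourhood: all mu'-incoherent tensors of the model in the ball
   Bopt(T). *)
Definition admissible_estimator (C0 Cgap mu' sigma : R) (r : 'I_m -> nat)
    (X : 'I_n -> Omega -> multi_index d) (xi : 'I_n -> {RV P >-> R})
    (T : tensor R d) (phi : estimator) : Prop :=
  [/\ measurable_estimator phi,
      forall x y, low_rank r (phi x y)
    & forall T' : tensor R d,
        incoherent_model mu' r T' -> Bopt C0 n sigma T T' ->
        rate_optimal C0 Cgap sigma X xi phi T' /\
        unbiased_within C0 sigma X xi phi T'].

Definition mean_squared_error (X : 'I_n -> Omega -> multi_index d)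
    (xi : 'I_n -> {RV P >-> R}) (phi : estimator) (T A : tensor R d) : \bar R :=
  (\int[P]_o ((inner (estimate X xi phi T o) A - inner T A) ^+ 2)%:E)%E.

End Sampling.

(* Main.v *)
(* The estimator is unbiased, within its accuracy ball, at every tensor of the
   model close to [T]; comparing [T] with one such tensor [T'] at a finite
   distance gives a Chapman-Robbins inequality.  Let [g] be the error of the
   linear form, [L] the likelihood ratio of [T'] to [T], and [1_T], [1_T'] the
   indicators of the two accuracy balls.  Unbiasedness at [T] and [T'] gives
     <T' - T, I> = E[g (L 1_T' - 1_T)] + <T, I> E[L 1_T' - 1_T],
   and the last term and the indicators cost only the gap probability.  The
   second moment of [L] is explicit because each observation is a shifted
   Gaussian at a uniform position.
   The step [T' - T] cannot be infinitesimal, since the gap probability does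
   not vanish with it.  It follows the tangent direction [P_T(I)] along a curve
   in the model, with chi-square distance of order [tau ^ 2] for [tau] a
   negative power of [M = max(dbar ^ m, n, lambda / sigma)].  Curvature and
   chi-square corrections then are of order [tau] up to powers of [M], the gap
   terms are a large negative power of [M], and [eps_snr ^ 2 >= M ^ -3], so all
   corrections are absorbed once [M] is large, which [eps_snr --> 0] forces. *)
Require Import Defs.
From HB Require Import structures.
From mathcomp Require Import all_boot all_order all_algebra.
From mathcomp Require Import all_classical all_reals all_analysis.
From mathcomp Require Import measurable_realfun ring lra.
Import Order.TTheory GRing.Theory Num.Theory.
Import numFieldNormedType.Exports.
Local Open Scope classical_set_scope.
Local Open Scope ring_scope.

(** * Integration against weighted image measures *)

(** Let [z = 1 / M] and let [S] be the maximum inside [eps_snr]. The usable lower bound is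
    [eps_snr ^ 2 >= S * z ^ 3], so the sum of all corrections, relative to the main term, must stay
    below it. By the alignment hypothesis the l1 norm of [I] is at most [S / z] times the norm of
    [P_T(I)], so curvature costs about [S * tau / z]: [tau = z ^ 5] leaves [S * z ^ 4], and the
    spare [z] absorbs the factor [4 ^ m.+1] of the Taylor remainder. Separating [L] from the
    accuracy event of [T] costs [r / tau ^ 2], where [r ^ 2] must dominate the gap probability;
    [r = z ^ 15] makes this [z ^ 5] and asks for a gap probability [z ^ 30]. Perturbing [T] may
    halve the scale, which doubles the exponent to [Cgap = 60]. Independence is given on product
    sets only, so the change of measure is proved as an equality of two weighted image measures: the
    positions take finitely many values, and at fixed positions the measures are compared on
    boxes. *)

Section WeightedLaw.
Context {d d' : measure_display} {T : measurableType d}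
  {T' : measurableType d'} {R : realType}.
Variables (mu : {measure set T -> \bar R}) (w : T -> R) (h : T -> T').
Hypotheses (w0 : forall x, 0 <= w x) (mw : measurable_fun setT w)
  (mh : measurable_fun setT h).
Local Open Scope ereal_scope.

(** The image under [h] of the measure with density [w] with respect to [mu]. An identity between
    integrals of functions of a sample becomes an identity of two measures, to be checked on
    generators. *)
Definition weighted_law (B : set T') : \bar R :=
  \int[mu]_(x in h @^-1` B) (w x)%:E.

Let mhB B : measurable B -> measurable (h @^-1` B).
Proof. by move=> mB; rewrite -[X in measurable X]setTI; exact: mh. Qed.

Let wl0 : weighted_law set0 = 0.
Proof. by rewrite /weighted_law preimage_set0 integral_set0. Qed.

Let wl_ge0 B : 0 <= weighted_law B.
Proof. by apply: integral_ge0 => x _; rewrite lee_fin. Qed.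

Let wl_sigma_additive : semi_sigma_additive weighted_law.
Proof.
move=> A mA tA mUA; rewrite /weighted_law preimage_bigcup.
rewrite ge0_integral_bigcup//=.
- apply: is_cvg_ereal_nneg_natsum_cond => n _ _.
  by apply: integral_ge0 => x _; rewrite lee_fin.
- by move=> k; exact: mhB.
- by apply/measurable_EFinP; exact: measurable_funTS.
- by move=> x _; rewrite lee_fin.
- apply/trivIsetP => /= i j _ _ ij; rewrite -preimage_setI.
  by move/trivIsetP : tA => /(_ _ _ _ _ ij) ->//; rewrite preimage_set0.
Qed.

HB.instance Definition _ := isMeasure.Build _ _ _ weighted_law
  wl0 wl_ge0 wl_sigma_additive.

Definition weighted_measure : {measure set T' -> \bar R} := weighted_law.

Lemma weighted_lawE B :
  weighted_law B = \int[mu]_x (w x * \1_B (h x))%:E.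
Proof.
rewrite /weighted_law integral_mkcond.
apply: eq_integral => x _; rewrite patchE indicE.
have -> : (x \in h @^-1` B) = (h x \in B) by apply/idP/idP; rewrite !inE.
by case: ifP; rewrite ?mulr1 ?mulr0.
Qed.

Import HBNNSimple.

(** Indicators are covered by [weighted_lawE]; linearity gives simple functions, and monotone
    convergence on both sides the rest. *)
Lemma ge0_integral_weighted (f : T' -> \bar R) :
  measurable_fun setT f -> (forall y, 0 <= f y) ->
  \int[weighted_measure]_y f y = \int[mu]_x ((w x)%:E * f (h x)).
Proof.
move=> mf f0.
pose f_ := nnsfun_approx measurableT mf.
have mwf n : measurable_fun setT (fun x => (w x)%:E * (f_ n (h x))%:E).
  apply: emeasurable_funM; first exact/measurable_EFinP.
  by apply/measurable_EFinP; apply: measurableT_comp.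
transitivity (limn (fun n => \int[weighted_measure]_y (f_ n y)%:E)).
  rewrite -monotone_convergence//.
  - apply: eq_integral => y _; apply/esym/cvg_lim => //.
    by apply: cvg_nnsfun_approx.
  - by move=> n; exact/measurable_EFinP/measurable_funP.
  - by move=> n y _; rewrite lee_fin.
  - by move=> y _ m n mn; rewrite lee_fin; exact/lefP/nd_nnsfun_approx.
transitivity (limn (fun n => \int[mu]_x ((w x)%:E * (f_ n (h x))%:E))); last first.
  rewrite -monotone_convergence//.
  - apply: eq_integral => x _; apply/cvg_lim => //.
    by apply: cvgeZl => //; apply: cvg_nnsfun_approx.
  - by move=> n x _; rewrite mule_ge0// lee_fin.
  - move=> x _ m n mn; rewrite lee_wpmul2l ?lee_fin//.
    exact/lefP/nd_nnsfun_approx.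
congr (limn _); apply/funext => n.
transitivity (\sum_(k \in range (f_ n))
    \int[weighted_measure]_y (k * \1_(f_ n @^-1` [set k]) y)%:E).
  under eq_integral do rewrite fimfunE -fsumEFin//.
  rewrite ge0_integral_fsum//.
  - by move=> y; exact/measurable_EFinP/measurable_funM.
  - by move=> y x _; rewrite nnfun_muleindic_ge0.
transitivity (\sum_(k \in range (f_ n))
    \int[mu]_x (w x * (k * \1_(f_ n @^-1` [set k]) (h x)))%:E); last first.
  under [RHS]eq_integral => x _.
    rewrite -EFinM fimfunE fsbig_distrr//= -fsumEFin//; over.
  rewrite ge0_integral_fsum//.
  - move=> y; apply/measurable_EFinP; apply: measurable_funM => //.
    by apply: measurable_funM => //; apply: measurableT_comp.
  - move=> y x _; rewrite EFinM mule_ge0 ?lee_fin//.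
    by have := nnfun_muleindic_ge0 (f_ n) y (h x); rewrite lee_fin.
apply: eq_fsbigr => r /[!inE] -[y0 _ <-].
rewrite integralZl_indic_nnsfun// integral_indic// setIT.
rewrite [weighted_measure _](weighted_lawE (f_ n @^-1` [set f_ n y0])).
under [RHS]eq_integral do rewrite mulrCA EFinM.
rewrite ge0_integralZl//.
- apply/measurable_EFinP; apply: measurable_funM => //.
  by apply: measurableT_comp.
- by move=> x _; rewrite lee_fin mulr_ge0.
- by rewrite lee_fin.
Qed.

End WeightedLaw.

Lemma eq_weighted_integral {d1 d2 d' : measure_display}
    {T1 : measurableType d1} {T2 : measurableType d2} {T' : measurableType d'}
    {R : realType} (mu1 : {measure set T1 -> \bar R})
    (mu2 : {measure set T2 -> \bar R}) (w1 : T1 -> R) (w2 : T2 -> R)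
    (h1 : T1 -> T') (h2 : T2 -> T') (f : T' -> R) :
  (forall x, 0 <= w1 x) -> measurable_fun setT w1 -> measurable_fun setT h1 ->
  (forall x, 0 <= w2 x) -> measurable_fun setT w2 -> measurable_fun setT h2 ->
  (forall B, measurable B ->
     (\int[mu1]_x (w1 x * \1_B (h1 x))%:E =
      \int[mu2]_x (w2 x * \1_B (h2 x))%:E)%E) ->
  measurable_fun setT f -> (forall y, 0 <= f y) ->
  (\int[mu1]_x (w1 x * f (h1 x))%:E = \int[mu2]_x (w2 x * f (h2 x))%:E)%E.
Proof.
move=> w10 mw1 mh1 w20 mw2 mh2 H mf f0.
have mf' : measurable_fun setT (EFin \o f) by exact/measurable_EFinP.
have f0' y : (0 <= (EFin \o f) y)%E by rewrite lee_fin.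
have := ge0_integral_weighted mu1 w1 h1 w10 mw1 mh1 _ mf' f0'.
have := ge0_integral_weighted mu2 w2 h2 w20 mw2 mh2 _ mf' f0'.
move=> <- <-; apply: eq_measure_integral => B mB _.
by rewrite [LHS]weighted_lawE [RHS]weighted_lawE H.
Qed.

(** * Gaussian shifts *)

Lemma ge0_integral_normal_prob {R : realType} (c s : R) (f : R -> R) :
  measurable_fun setT f -> (forall y, 0 <= f y) ->
  (\int[normal_prob c s]_y (f y)%:E =
   \int[lebesgue_measure]_x (normal_pdf c s x * f x)%:E)%E.
Proof.
move=> mf f0.
have mf' : measurable_fun setT (EFin \o f) by exact/measurable_EFinP.
have f0' y : (0 <= (EFin \o f) y)%E by rewrite lee_fin.
have := ge0_integral_weighted (@lebesgue_measure R) (normal_pdf c s) idfun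
  (normal_pdf_ge0 c s) (measurable_normal_pdf c s) (@measurable_id _ _ _) _ mf' f0'.
by move=> <-; apply: eq_measure_integral.
Qed.

(** The image of Lebesgue measure under the translation gives half-open intervals their length,
    which determines it. *)
Lemma ge0_integral_lebesgue_shift {R : realType} (c : R) (f : R -> R) :
  measurable_fun setT f -> (forall y, 0 <= f y) ->
  (\int[lebesgue_measure]_x (f (x + c))%:E =
   \int[lebesgue_measure]_x (f x)%:E)%E.
Proof.
move=> mf f0.
have mf' : measurable_fun setT (EFin \o f) by exact/measurable_EFinP.
have mc : measurable_fun setT
  ((fun x : R => x + c) : measurableTypeR R -> measurableTypeR R).
  exact: measurable_funD.
pose m := weighted_measure (@lebesgue_measure R) (cst 1) _
  (fun=> ler01) (measurable_cst _) mc.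
transitivity (\int[m]_x (f x)%:E)%E.
  rewrite (ge0_integral_weighted _ _ _ (fun=> ler01) (measurable_cst _) mc
    (EFin \o f) mf')//.
  by apply: eq_integral => x _; rewrite mul1e.
apply/esym; apply: eq_measure_integral => A mA _.
apply: lebesgue_measure_unique => //= _ [[a b]] _ <-.
rewrite /weighted_law.
have -> : (fun x : R => x + c) @^-1` `]a, b]%classic = `]a - c, b - c]%classic.
  by apply/seteqP; split=> x /=; rewrite !in_itv/= ltrBlDr lerBrDr.
rewrite (eq_integral (cst 1%E))// integral_cst// mul1e [LHS]lebesgue_measure_itv.
rewrite [RHS]lebesgue_measure_itv/= !lte_fin ltrD2r; case: ifP => // _. 
by rewrite -!EFinB; congr EFin; ring.
Qed.

(* [tilt s a z] is the density of N(a, s^2) with respect to N(0, s^2). *)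
Definition tilt {R : realType} (s a z : R) : R :=
  expR ((a * z - a ^+ 2 / 2) / s ^+ 2).

Lemma measurable_tilt {R : realType} (s a : R) : measurable_fun setT (tilt s a).
Proof.
apply: measurableT_comp => //; apply: measurable_funM => //.
by apply: measurable_funB => //; apply: measurable_funM.
Qed.

Lemma tilt_ge0 {R : realType} (s a z : R) : 0 <= tilt s a z.
Proof. exact: expR_ge0. Qed.

Lemma normal_pdf_tilt {R : realType} (s a z : R) : s != 0 ->
  normal_pdf 0 s (z + a) * tilt s a (z + a) = normal_pdf 0 s z.
Proof.
move=> s0; rewrite !normal_pdfE// /normal_fun /tilt -mulrA -expRD.
by congr (_ * expR _); field.
Qed.

(** The one-dimensional Cameron-Martin formula: after translating the right-hand Lebesgue integral
    by [a], the integrands agree pointwise by [normal_pdf_tilt]. *)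
Lemma integral_normal_shift {R : realType} (s a : R) (f : R -> R) : s != 0 ->
  measurable_fun setT f -> (forall y, 0 <= f y) ->
  (\int[normal_prob 0 s]_y (f ((y : R) + a)%R)%:E =
   \int[normal_prob 0 s]_y (f y * tilt s a y)%:E)%E.
Proof.
move=> s0 mf f0.
have mfa : measurable_fun setT (fun y : R => f (y + a)).

  by apply: measurableT_comp => //; exact: measurable_funD.
have mft : measurable_fun setT (fun y => f y * tilt s a y).
  by apply: measurable_funM => //; exact: measurable_tilt.
rewrite !ge0_integral_normal_prob//; last first.
  by move=> y; rewrite mulr_ge0// tilt_ge0.
rewrite -[RHS](ge0_integral_lebesgue_shift a).
- apply: eq_integral => x _; rewrite -(normal_pdf_tilt s a x)//; congr EFin.
  by rewrite -mulrA [f _ * _]mulrC.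
- by apply: measurable_funM => //; exact: measurable_normal_pdf.
- by move=> y; rewrite !mulr_ge0// ?tilt_ge0 ?normal_pdf_ge0.
Qed.

Lemma integral_tilt {R : realType} (s a : R) : s != 0 ->
  (\int[normal_prob 0 s]_y (tilt s a y)%:E = 1)%E.
Proof.
move=> s0.
have := integral_normal_shift s a (cst 1) s0 (measurable_cst _) (fun=> ler01).
under [X in _ = X -> _]eq_integral do rewrite mul1r.
move=> <-; rewrite (eq_integral (cst 1%E))// integral_cst//.
by rewrite mul1e; exact: probability_setT.
Qed.

(** Completing the square, [tilt s a ^ 2] is a constant times the tilt by [2 * a], which has mean
    one. *)
Lemma integral_tilt_sqr {R : realType} (s a : R) : s != 0 ->
  (\int[normal_prob 0 s]_y (tilt s a y ^+ 2)%:E =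
   (expR (a ^+ 2 / s ^+ 2))%:E)%E.
Proof.
move=> s0.
transitivity (\int[normal_prob 0 s]_y ((expR (a ^+ 2 / s ^+ 2))%:E
    * (tilt s (a + a) y)%:E))%E.
  apply: eq_integral => y _; rewrite -EFinM; congr EFin.
  by rewrite /tilt expr2 -!expRD; congr expR; field.
rewrite ge0_integralZl//.
- by rewrite integral_tilt// mule1.
- by apply/measurable_EFinP; exact: measurable_tilt.
- by move=> y _; rewrite lee_fin tilt_ge0.
Qed.

(** * Product structure *)

Definition box {T : Type} {n : nat} (B : 'I_n -> set T) : set (n.-tuple T) :=
  [set y | forall i, B i (tnth y i)].

Lemma indic_box {R : realType} {T : Type} {n : nat} (B : 'I_n -> set T)
    (y : n.-tuple T) :
  \1_(box B) y = \prod_(i < n) \1_(B i) (tnth y i) :> R.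
Proof.
rewrite indicE; have [yB|yB] := boolP (y \in box B).
  rewrite big1// => i _; rewrite indicE mem_set//.
  by move: yB; rewrite inE; apply.
have [i Bi] : exists i, ~ B i (tnth y i).
  by apply/existsNP => H; move: yB; rewrite notin_setE.
by rewrite (bigD1 i)//= indicE memNset// mul0r.
Qed.

(** Cylinders over one coordinate are boxes whose other sides are full. Boxes, unlike these
    cylinders, are stable under intersection, which uniqueness of measures requires. *)
Lemma tuple_measurableE {d : measure_display} {T : measurableType d} {n : nat} :
  @measurable _ (n.-tuple T) =
  <<s [set box B | B in [set B | forall i, measurable (B i)]] >>.
Proof.
apply/seteqP; split; last first.
  apply: smallest_sub; first exact: sigma_algebra_measurable.
  move=> _ [B mB <-].
  have -> : box B = \big[setI/setT]_(i < n) ((@tnth n T)^~ i @^-1` B i).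
    rewrite -bigcap_seq; apply/seteqP; split=> y yB i /=; first by move=> _; exact: yB.
    by apply: yB; rewrite /= mem_index_enum.
  apply: bigsetI_measurable => i _; rewrite -[X in measurable X]setTI.
  by apply: measurable_tnth => //; exact: mB.
apply: smallest_sub; first exact: smallest_sigma_algebra.
move=> A; rewrite -bigcup_seq => -[i _ [B mB <-]].
apply: sub_sigma_algebra; exists (fun j => if j == i then B else setT).
  by move=> j /=; case: ifP.
rewrite setTI; apply/seteqP; split=> y /= yB.
  by have := yB i; rewrite eqxx.
by move=> j; case: ifP => // /eqP ->.
Qed.

Lemma eq_weighted_integral_tuple {d1 d2 d' : measure_display}
    {T1 : measurableType d1} {T2 : measurableType d2} {T' : measurableType d'}
    {R : realType} {n : nat} (mu1 : {measure set T1 -> \bar R})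
    (mu2 : {measure set T2 -> \bar R}) (w1 : T1 -> R) (w2 : T2 -> R)
    (h1 : T1 -> n.-tuple T') (h2 : T2 -> n.-tuple T') (f : n.-tuple T' -> R) :
  (forall x, 0 <= w1 x) -> measurable_fun setT w1 -> measurable_fun setT h1 ->
  (forall x, 0 <= w2 x) -> measurable_fun setT w2 -> measurable_fun setT h2 ->
  (\int[mu1]_x (w1 x)%:E < +oo)%E ->
  (forall B : 'I_n -> set T', (forall i, measurable (B i)) ->
     (\int[mu1]_x (w1 x * \prod_(i < n) \1_(B i) (tnth (h1 x) i))%:E =
      \int[mu2]_x (w2 x * \prod_(i < n) \1_(B i) (tnth (h2 x) i))%:E)%E) ->
  measurable_fun setT f -> (forall y, 0 <= f y) ->
  (\int[mu1]_x (w1 x * f (h1 x))%:E = \int[mu2]_x (w2 x * f (h2 x))%:E)%E.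
Proof.
move=> w10 mw1 mh1 w20 mw2 mh2 fin H.
apply: eq_weighted_integral => // B mB.
rewrite -!weighted_lawE.
pose m1 := weighted_measure mu1 w1 h1 w10 mw1 mh1.
pose m2 := weighted_measure mu2 w2 h2 w20 mw2 mh2.
apply: (measure_unique _ (fun=> setT) tuple_measurableE _ _ _ m1 m2) => //.
- move=> _ _ [A mA <-] [C mC <-]; exists (fun i => A i `&` C i).
    by move=> i; exact: measurableI.
  apply/seteqP; split=> y /= yAC; first by split=> i; case: (yAC i).
  by move=> i; split; [case: yAC|case: yAC].
- by move=> _; exists (fun=> setT) => //; apply/seteqP; split.
- by rewrite bigcup_const.
- move=> _ [A mA <-]; rewrite [LHS]weighted_lawE [RHS]weighted_lawE.
  by under eq_integral do rewrite indic_box; rewrite H//;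
     under eq_integral do rewrite -indic_box.
Qed.

(** The hypothesis is independence in product form, known for indicators; they are exchanged for
    general functions one coordinate at a time. *)
Lemma integral_prod_indep {d d' : measure_display} {T : measurableType d}
    {T' : measurableType d'} {R : realType} {n : nat}
    (mu : {measure set T -> \bar R}) (nu : probability T' R) (v : T -> R)
    (z : 'I_n -> T -> T') (k : R) (f : 'I_n -> T' -> R) (e : 'I_n -> R) :
  (forall x, 0 <= v x) -> measurable_fun setT v ->
  (forall i, measurable_fun setT (z i)) -> 0 <= k ->
  (forall B : 'I_n -> set T', (forall i, measurable (B i)) ->
    (\int[mu]_x (v x * \prod_(i < n) \1_(B i) (z i x))%:E =
     (k * \prod_(i < n) fine (nu (B i)))%:E)%E) ->
  (forall i, measurable_fun setT (f i)) -> (forall i y, 0 <= f i y) ->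
  (forall i, \int[nu]_y (f i y)%:E = (e i)%:E)%E ->
  (\int[mu]_x (v x * \prod_(i < n) f i (z i x))%:E =
   (k * \prod_(i < n) e i)%:E)%E.
Proof.
move=> v0 mv mz k0 H.
(* Invariant of the induction: the factors of index at least [j] are still indicators. For [j = n]
   this is no restriction. *)
suff main (j : nat) : forall (f : 'I_n -> T' -> R) (e : 'I_n -> R),
    (forall i : 'I_n, measurable_fun setT (f i)) ->
    (forall i y, 0 <= f i y) ->
    (forall i, \int[nu]_y (f i y)%:E = (e i)%:E)%E ->
    (forall i : 'I_n, (j <= i)%N ->
       exists2 B, measurable B & f i = \1_B) ->
    (\int[mu]_x (v x * \prod_(i < n) f i (z i x))%:E =
     (k * \prod_(i < n) e i)%:E)%E.
  move=> mf f0 ef; apply: (main n) => // i.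
  by rewrite leqNgt ltn_ord.
elim: j => [|j IH] {}f {}e mf f0 ef fB.
  have /choice[B HB] : forall i, exists B, measurable B /\ f i = \1_B.
    by move=> i; have [B mB ->] := fB i isT; exists B.
  transitivity (k * \prod_(i < n) fine (nu (B i)))%:E.
    rewrite -H; last by move=> i; case: (HB i).
    apply: eq_integral => x _; congr (_ * _)%:E; apply: eq_bigr => i _.
    by rewrite (HB i).2.
  congr (_ * _)%:E; apply: eq_bigr => i _.
  have := ef i; rewrite (HB i).2 integral_indic ?setIT; last first.
  - by case: (HB i).
  - by [].
  by move=> ->.
have [jn|nj] := ltnP j n; last first.
  by apply: IH => // i ji; move: (ltn_ord i); rewrite ltnNge (leq_trans nj).
pose j0 := Ordinal jn.
have e0 i : 0 <= e i.
  rewrite -lee_fin -ef; apply: integral_ge0 => y _; rewrite lee_fin//.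
under eq_integral do rewrite (bigD1 j0)//= mulrCA mulrC.
(* All factors except the one at [j0] move into the weight, so only the law of [z j0] under that
   weight matters; the induction hypothesis, with an indicator placed at [j0], identifies it. *)
rewrite (eq_weighted_integral mu nu
  (fun x => v x * \prod_(i < n | i != j0) f i (z i x))
  (cst (k * \prod_(i < n | i != j0) e i)) (z j0) idfun)//.
- under eq_integral do rewrite /= EFinM.
  rewrite ge0_integralZl//=.
  + by rewrite ef -EFinM [in RHS](bigD1 j0)//= mulrA mulrAC.
  + by apply/measurable_EFinP.
  + by move=> y _; rewrite lee_fin.
  + by rewrite lee_fin mulr_ge0// prodr_ge0.
- by move=> x; rewrite mulr_ge0// prodr_ge0.
- apply: measurable_funM => //.
  rewrite (_ : (fun x => _) = fun x =>
      \prod_(i < n) if i != j0 then f i (z i x) else 1); last first.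
    by apply/funext => x; rewrite big_mkcond.
  apply: measurable_prod => i _; case: (i != j0); last exact: measurable_cst.
  by apply: measurableT_comp; [exact: mf|exact: mz].
- by move=> x; rewrite /= mulr_ge0// prodr_ge0.
- exact: measurable_id.
- move=> B mB.
  pose g i := if i == j0 then \1_B else f i.
  pose ge i := if i == j0 then fine (nu B) else e i.
  transitivity (\int[mu]_x (v x * \prod_(i < n) g i (z i x))%:E)%E.
    apply: eq_integral => x _; rewrite [in RHS](bigD1 j0)//=.
    rewrite /g eqxx -mulrA [X in _ * X]mulrC; congr (_ * (_ * _))%:E.
    by apply: eq_bigr => i /negbTE ->.
  rewrite (IH g ge).
  + under eq_integral do rewrite /= EFinM.
    rewrite ge0_integralZl//=.
    * rewrite integral_indic// setIT (bigD1 j0)//= /ge eqxx.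
      rewrite -[in RHS](@fineK _ (nu B)) ?fin_num_measure// -EFinM.
      rewrite -mulrA [X in _ * X]mulrC; congr (_ * (_ * _))%:E.
      by apply: eq_bigr => i /negbTE ->.
    * by apply/measurable_EFinP; exact: measurable_indic.
    * by rewrite lee_fin mulr_ge0// prodr_ge0.
  + by move=> i; rewrite /g; case: ifP => // _; exact: measurable_indic.
  + by move=> i y; rewrite /g; case: ifP.
  + move=> i; rewrite /g /ge; case: ifP => // _.
    by rewrite integral_indic// setIT fineK// fin_num_measure.
  + move=> i ji; rewrite /g; case: ifPn => [_|ij]; first by exists B.
    apply: fB; rewrite ltn_neqAle ji andbT eq_sym.
    by apply: contra ij => /eqP ij; apply/eqP/val_inj.
Qed.

(** * Change of measure for the sample *)

Lemma inner_basis {R : realType} {m : nat} {d : 'I_m -> nat}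
    (A : tensor R d) (w : multi_index d) : inner A (basis_tensor R w) = A w.
Proof.
rewrite /inner (bigD1 w)//= ffunE eqxx mulr1 big1 ?addr0// => v vw.
by rewrite ffunE (negbTE vw) mulr0.
Qed.

Section Sampling.
Context {R : realType} {m : nat} {d : 'I_m -> nat} {n : nat}
  {disp : measure_display} {Omega : measurableType disp}
  {P : probability Omega R}.
Variables (s : R) (X : 'I_n -> Omega -> multi_index d)
  (xi : 'I_n -> {RV P >-> R}).
Hypotheses (s0 : s != 0) (sampling : uniform_gaussian_sampling s X xi).

Definition positions (o : Omega) : n.-tuple (multi_index d) :=
  [tuple X i o | i < n].

Definition responses (A : tensor R d) (o : Omega) : n.-tuple R :=
  [tuple response X xi A i o | i < n].

Definition at_positions (x : {ffun 'I_n -> multi_index d}) (o : Omega) : R :=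
  \prod_(i < n) (X i o == x i)%:R.

Lemma at_positions_ge0 x o : 0 <= at_positions x o.
Proof. by apply: prodr_ge0 => i _; rewrite ler0n. Qed.

Lemma measurable_at_positions x : measurable_fun setT (at_positions x).
Proof.
apply: measurable_prod => i _.
have -> : (fun o => (X i o == x i)%:R) = \1_(X i @^-1` [set x i]) :> (_ -> R).
  apply/funext => o; rewrite indicE; congr (nat_of_bool _)%:R.
  by apply/eqP/idP; rewrite inE.
by apply: measurable_indic; case: sampling.
Qed.

(** Conditioning on the positions in finite form: exactly one [at_positions x] is one, so a function
    of the sample splits into finitely many functions of the noise alone. *)
Lemma sum_at_positions (G : n.-tuple (multi_index d) -> R) o :
  G (positions o) = \sum_x at_positions x o * G [tuple x i | i < n].
Proof.
rewrite (bigD1 [ffun i => X i o])//= [X in _ + X]big1 ?addr0 => [|x xX].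
  rewrite /at_positions big1 ?mul1r => [|i _]; last by rewrite ffunE eqxx.
  by congr G; apply: eq_from_tnth => i; rewrite !tnth_mktuple ffunE.
have [i xi_neq] : exists i, x i != X i o.
  apply/existsP; apply: contraNT xX; rewrite negb_exists => /forallP H.
  by apply/eqP/ffunP => i; rewrite ffunE; apply/eqP; rewrite -[_ == _]negbK.
by rewrite /at_positions (bigD1 i)//= eq_sym (negbTE xi_neq) !mul0r.
Qed.

Lemma integral_at_positions_box x (B : 'I_n -> set R) :
  (forall i, measurable (B i)) ->
  (\int[P]_o (at_positions x o * \prod_(i < n) \1_(B i) (xi i o))%:E =
   ((dstar d)%:R^-1 ^+ n * \prod_(i < n) fine (normal_prob 0 s (B i)))%:E)%E.
Proof.
move=> mB; have [mX PX Pxi indep] := sampling.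
pose E := [set o | forall i, [set x i] (X i o) /\ B i (xi i o)].
have mE : measurable E.
  have -> : E = \big[setI/setT]_(i < n)
      ((X i @^-1` [set x i]) `&` (xi i @^-1` B i)).
    rewrite -bigcap_seq; apply/seteqP; split=> o oE i /=; first by move=> _; exact: oE.
    by apply: oE; rewrite /= mem_index_enum.
  apply: bigsetI_measurable => i _; apply: measurableI => //.
  by rewrite -[X in measurable X]setTI; exact: measurable_funP.
transitivity (\int[P]_o (\1_E o)%:E)%E.
  apply: eq_integral => o _; congr EFin.
  rewrite /at_positions -big_split/= indicE.
  have [oE|oE] := boolP (o \in E).
    move: oE; rewrite inE => oE.
    rewrite big1// => i _; have [/= -> Bi] := oE i.
    by rewrite eqxx indicE mem_set// mulr1.
  have [i Ei] : exists i, ~ ([set x i] (X i o) /\ B i (xi i o)).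
    by apply/existsNP => H; move: oE; rewrite notin_setE.
  rewrite (bigD1 i)//= indicE; case: eqP => Xi; last by rewrite !mul0r.
  by rewrite memNset ?mulr0 ?mul0r// => Bi; apply: Ei.
rewrite integral_indic// setIT [LHS](indep (fun i => [set x i]) B mB).
have -> : (dstar d)%:R^-1 ^+ n = \prod_(i < n) (dstar d)%:R^-1 :> R.
  by rewrite prodr_const card_ord.
rewrite -big_split/= -prodEFin; apply: eq_bigr => i _.
rewrite EFinM PX; congr (_ * _)%E.
have -> : P (xi i @^-1` B i) = normal_prob 0 s (B i) by rewrite -(Pxi i).
by rewrite fineK // ; apply: fin_num_measure; exact: mB.
Qed.

Let kappa_ge0 : 0 <= (dstar d)%:R^-1 ^+ n :> R.
Proof. by rewrite exprn_ge0// invr_ge0 ler0n. Qed.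

Let mxi i : measurable_fun setT (xi i).
Proof. exact: measurable_funP. Qed.

Lemma integral_at_positions_prod x (f : 'I_n -> R -> R) (e : 'I_n -> R) :
  (forall i, measurable_fun setT (f i)) -> (forall i y, 0 <= f i y) ->
  (forall i, \int[normal_prob 0 s]_y (f i y)%:E = (e i)%:E)%E ->
  (\int[P]_o (at_positions x o * \prod_(i < n) f i (xi i o))%:E =
   ((dstar d)%:R^-1 ^+ n * \prod_(i < n) e i)%:E)%E.
Proof.
move=> mf f0 ef.
apply: (integral_prod_indep P (normal_prob 0 s) (at_positions x)) => //.
- exact: at_positions_ge0.
- exact: measurable_at_positions.
- by move=> B mB; exact: integral_at_positions_box.
Qed.

Lemma measurable_prod_tilt (a : 'I_n -> R) :
  measurable_fun setT (fun o => \prod_(i < n) tilt s (a i) (xi i o)).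
Proof.
apply: measurable_prod => i _; apply: measurableT_comp => //.
exact: measurable_tilt.
Qed.

(** On boxes both sides are products of one-dimensional integrals, equal factor by factor by the
    Gaussian shift; equality on boxes then extends to all [F]. *)
Lemma integral_at_positions_shift x (a b : 'I_n -> R) (F : n.-tuple R -> R) :
  measurable_fun setT F -> (forall y, 0 <= F y) ->
  (\int[P]_o (at_positions x o *
      F [tuple b i + xi i o | i < n])%:E =
   \int[P]_o (at_positions x o * \prod_(i < n) tilt s (b i - a i) (xi i o) *
      F [tuple a i + xi i o | i < n])%:E)%E.
Proof.
move=> mF F0.
have mtup (c : 'I_n -> R) :
    measurable_fun setT (fun o => [tuple c i + xi i o | i < n]).
  apply/measurable_fun_tnthP => i.
  rewrite (_ : _ \o _ = fun o => c i + xi i o); last first.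
    by apply/funext => o /=; rewrite tnth_mktuple.
  exact: measurable_funD.
apply: (eq_weighted_integral_tuple P P (at_positions x) _
  (fun o => [tuple b i + xi i o | i < n])
  (fun o => [tuple a i + xi i o | i < n])) => //.
- exact: at_positions_ge0.
- exact: measurable_at_positions.
- by move=> o; rewrite mulr_ge0 ?at_positions_ge0// prodr_ge0// => i _; exact: tilt_ge0.
- apply: measurable_funM; first exact: measurable_at_positions.
  exact: measurable_prod_tilt.
- apply: le_lt_trans (ltry 1); rewrite -(@probability_setT _ _ _ P) -[X in (_ <= X)%E]mul1e.
  rewrite -integral_cst//; apply: ge0_le_integral => //.
  + by move=> o _; rewrite lee_fin at_positions_ge0.
  + exact/measurable_EFinP/measurable_at_positions.
  + move=> o _; rewrite lee_fin /at_positions.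
    by apply: prodr_ile1 => i _; case: (_ == _); rewrite ?lexx ?ler01.
- move=> B mB.
  have mshift c i : measurable ((fun z : R => c + z) @^-1` B i).
    rewrite -[X in measurable X]setTI.
    suff : measurable_fun setT (fun z : R => c + z) by apply => //; exact: mB.
    exact: measurable_funD.
  have shiftE c i : (fun z => \1_(B i) (c + z)) =
      \1_((fun z : R => c + z) @^-1` B i) :> (R -> R).
    apply/funext => z; rewrite !indicE.
    suff -> : (c + z \in B i) = (z \in (fun z : R => c + z) @^-1` B i) by [].
    by apply/idP/idP; rewrite !inE.
  have mI c i : measurable_fun setT (fun z : R => \1_(B i) (c + z) : R).
    by rewrite shiftE; exact: measurable_indic.
  have E i : (\int[normal_prob 0 s]_z (\1_(B i) (b i + z))%:E =
     (fine (\int[normal_prob 0 s]_z (\1_(B i) (b i + z))%:E)%E)%:E)%E.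
    rewrite fineK//.
    under eq_integral do rewrite -[\1_(B i) _]/((fun z => \1_(B i) (b i + z)) _) shiftE.
    rewrite integral_indic//; last exact: mshift.
    by rewrite setIT; apply: fin_num_measure; exact: mshift.
  transitivity (((dstar d)%:R^-1 ^+ n * \prod_(i < n)
      fine (\int[normal_prob 0 s]_z (\1_(B i) (b i + z))%:E)%E)%:E).
    rewrite -(integral_at_positions_prod x (fun i z => \1_(B i) (b i + z)))//.
    + apply: eq_integral => o _; congr (_ * _)%:E; apply: eq_bigr => i _.
      by rewrite tnth_mktuple.
  rewrite -(integral_at_positions_prod x (fun i z => \1_(B i) (a i + z) * tilt s (b i - a i) z))//.
  + apply: eq_integral => o _; rewrite -[in RHS]mulrA.
    rewrite -[X in (_ = (_ * X)%:E)%E]big_split/=; congr (_ * _)%:E.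
    apply: eq_bigr => i _.
    by rewrite tnth_mktuple mulrC.
  + move=> i; apply: measurable_funM; last exact: measurable_tilt.
    exact: mI.
  + by move=> i y; rewrite mulr_ge0// tilt_ge0.
  + move=> i; rewrite -E -(integral_normal_shift s (b i - a i) (fun z => \1_(B i) (a i + z)))//.
    * by apply: eq_integral => z _; congr (\1_(B i) _)%:E; ring.
Qed.

(** The samples under [A] and [B] are built from the same [X] and [xi] on the same space. Under [A]
    the residual of the [i]-th response is [xi i], so this is the likelihood ratio of [B] to [A] at
    the sample of [A]. *)
Definition likelihood (A B : tensor R d) (o : Omega) : R :=
  \prod_(i < n) tilt s (B (X i o) - A (X i o)) (xi i o).

Lemma likelihood_ge0 A B o : 0 <= likelihood A B o.
Proof. by apply: prodr_ge0 => i _; exact: tilt_ge0. Qed.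

(* Functions of the sample: the positions take finitely many values, so only
   measurability in the responses is required. *)
Definition sample_measurable
    (F : n.-tuple (multi_index d) -> n.-tuple R -> R) : Prop :=
  forall x, measurable_fun setT (F x).

Lemma measurable_responses_at (A : tensor R d) (x : n.-tuple (multi_index d)) :
  measurable_fun setT (fun o => [tuple A (tnth x i) + xi i o | i < n]).
Proof.
apply/measurable_fun_tnthP => i.
rewrite (_ : _ \o _ = fun o => A (tnth x i) + xi i o); last first.
  by apply/funext => o /=; rewrite tnth_mktuple.
exact: measurable_funD.
Qed.

Lemma responsesE A o :
  responses A o = [tuple A (tnth (positions o) i) + xi i o | i < n].
Proof.
by apply: eq_from_tnth => i; rewrite !tnth_mktuple /response inner_basis.
Qed.

Lemma measurable_sample F A : sample_measurable F ->
  measurable_fun setT (fun o => F (positions o) (responses A o)).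
Proof.
move=> mF.
rewrite (_ : (fun o => _) = fun o => \sum_x at_positions x o *
    F [tuple x i | i < n] [tuple A (tnth [tuple x i | i < n] i) + xi i o | i < n]); last first.
  apply/funext => o; rewrite responsesE.
  by rewrite (sum_at_positions (fun p => F p [tuple A (tnth p i) + xi i o | i < n])).
apply: measurable_sum => x; apply: measurable_funM.
  exact: measurable_at_positions.
apply: measurableT_comp; first exact: mF.
exact: measurable_responses_at.
Qed.

Lemma measurable_likelihood A B : measurable_fun setT (likelihood A B).
Proof.
rewrite (_ : likelihood A B = fun o => \sum_x at_positions x o *
    \prod_(i < n) tilt s
      (B (tnth [tuple x i | i < n] i) - A (tnth [tuple x i | i < n] i)) (xi i o));
  last first.
  apply/funext => o.
  rewrite -(sum_at_positions (fun p =>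
    \prod_(i < n) tilt s (B (tnth p i) - A (tnth p i)) (xi i o))).
  by apply: eq_bigr => i _; rewrite tnth_mktuple.
apply: measurable_sum => x; apply: measurable_funM.
  exact: measurable_at_positions.
exact: measurable_prod_tilt.
Qed.

Lemma ge0_change_of_measure A B F : sample_measurable F ->
  (forall x y, 0 <= F x y) ->
  (\int[P]_o (F (positions o) (responses B o))%:E =
   \int[P]_o (likelihood A B o * F (positions o) (responses A o))%:E)%E.
Proof.
move=> mF F0.
pose Y (C : tensor R d) p o := [tuple C (tnth p i) + xi i o | i < n] : n.-tuple R.
pose L p o := \prod_(i < n) tilt s (B (tnth p i) - A (tnth p i)) (xi i o).
transitivity (\int[P]_o (\sum_x (at_positions x o *
    F [tuple x i | i < n] (Y B [tuple x i | i < n] o))%:E))%E.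
  apply: eq_integral => o _; rewrite responsesE sumEFin; congr EFin.
  by rewrite (sum_at_positions (fun p => F p (Y B p o))).
transitivity (\int[P]_o (\sum_x (at_positions x o * L [tuple x i | i < n] o *
    F [tuple x i | i < n] (Y A [tuple x i | i < n] o))%:E))%E; last first.
  apply: eq_integral => o _; rewrite responsesE sumEFin; congr EFin.
  under eq_bigr do rewrite -mulrA.
  rewrite -(sum_at_positions (fun p => L p o * F p (Y A p o))); congr (_ * _).
  by apply: eq_bigr => i _; rewrite tnth_mktuple.
rewrite !ge0_integral_sum//.
- apply: eq_bigr => x _.
  exact: (integral_at_positions_shift x (fun i => A (tnth [tuple x i | i < n] i))
    (fun i => B (tnth [tuple x i | i < n] i)) (F [tuple x i | i < n])).
- move=> x; apply/measurable_EFinP; apply: measurable_funM.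
    apply: measurable_funM; first exact: measurable_at_positions.
    exact: measurable_prod_tilt.
  apply: measurableT_comp; first exact: mF.
  exact: measurable_responses_at.
- move=> x o _; rewrite lee_fin !mulr_ge0 ?at_positions_ge0//.
  by apply: prodr_ge0 => i _; exact: tilt_ge0.
- move=> x; apply/measurable_EFinP; apply: measurable_funM.
    exact: measurable_at_positions.
  apply: measurableT_comp; first exact: mF.
  exact: measurable_responses_at.
- by move=> x o _; rewrite lee_fin !mulr_ge0 ?at_positions_ge0.
Qed.

(** One plus the chi-square divergence of the law under [B] from the law under [A]: one factor per
    observation, each an average over the uniform position. *)
Definition chi2 (A B : tensor R d) : R :=
  ((dstar d)%:R^-1 * \sum_w expR ((B w - A w) ^+ 2 / s ^+ 2)) ^+ n.

Lemma integral_likelihood_sqr A B :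
  (\int[P]_o (likelihood A B o ^+ 2)%:E = (chi2 A B)%:E)%E.
Proof.
pose L (x : {ffun 'I_n -> multi_index d}) o :=
  \prod_(i < n) (tilt s (B (x i) - A (x i)) (xi i o) ^+ 2).
transitivity (\int[P]_o (\sum_x (at_positions x o * L x o)%:E))%E.
  apply: eq_integral => o _; rewrite sumEFin; congr EFin.
  rewrite /likelihood -prodrXl.
  pose G (p : n.-tuple (multi_index d)) :=
    \prod_(i < n) (tilt s (B (tnth p i) - A (tnth p i)) (xi i o) ^+ 2).
  transitivity (G (positions o)).
    by apply: eq_bigr => i _; rewrite tnth_mktuple.
  rewrite sum_at_positions; apply: eq_bigr => x _; congr (_ * _).
  by apply: eq_bigr => i _; rewrite tnth_mktuple.
rewrite ge0_integral_sum//; last 2 first.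
- move=> x; apply/measurable_EFinP; apply: measurable_funM.
    exact: measurable_at_positions.
  apply: measurable_prod => i _; apply: measurable_funX.
  by apply: measurableT_comp => //; exact: measurable_tilt.
- move=> x o _; rewrite lee_fin mulr_ge0 ?at_positions_ge0//.
  by apply: prodr_ge0 => i _; rewrite exprn_ge0// tilt_ge0.
rewrite /chi2 exprMn.
(* Expanding the power gives one term per vector of positions, matching the partition by
   [at_positions]. *)
have -> : (\sum_w expR ((B w - A w) ^+ 2 / s ^+ 2)) ^+ n =
    \sum_(x : {ffun 'I_n -> multi_index d})
      \prod_(i < n) expR ((B (x i) - A (x i)) ^+ 2 / s ^+ 2).
  rewrite -(bigA_distr_bigA (fun (i : 'I_n) w => expR ((B w - A w) ^+ 2 / s ^+ 2))).
  by rewrite prodr_const card_ord.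
rewrite mulr_sumr -sumEFin; apply: eq_bigr => x _.
rewrite (integral_at_positions_prod x (fun i z => tilt s (B (x i) - A (x i)) z ^+ 2)
  (fun i => expR ((B (x i) - A (x i)) ^+ 2 / s ^+ 2)))//.
- by move=> i; apply: measurable_funX; exact: measurable_tilt.
- by move=> i y; rewrite exprn_ge0// tilt_ge0.
- by move=> i; rewrite integral_tilt_sqr.
Qed.

End Sampling.
Arguments chi2 {R m d} n s A B.

(** * The Chapman-Robbins inequality *)

Section Mean.
Context {R : realType} {disp : measure_display} {Omega : measurableType disp}
  {P : probability Omega R}.
Implicit Types (f g : Omega -> R) (a b k : R).

(** A finite value of the integral forces integrability, so the linearity rules below need no
    integrability side conditions. *)
Definition has_mean f a : Prop :=
  measurable_fun setT f /\ (\int[P]_o (f o)%:E = a%:E)%E.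

Lemma has_mean_integrable f a :
  has_mean f a -> P.-integrable setT (EFin \o f).
Proof.
move=> [mf fa]; apply/integrableP; split; first exact/measurable_EFinP.
by rewrite integral_fin_num_abs// fa.
Qed.

Lemma has_mean_cst k : has_mean (cst k) k.
Proof.
split=> //; rewrite (eq_integral (cst k%:E))// integral_cst//.
by rewrite [X in (_ * X)%E]probability_setT mule1.
Qed.

Lemma has_meanD f g a b :
  has_mean f a -> has_mean g b -> has_mean (fun o => f o + g o) (a + b).
Proof.
move=> fa gb; split; first by apply: measurable_funD; [case: fa|case: gb].
under eq_integral do rewrite EFinD.
rewrite integralD//; [|exact: has_mean_integrable fa|exact: has_mean_integrable gb].
by rewrite fa.2 gb.2.
Qed.

Lemma has_meanZ k f a : has_mean f a -> has_mean (fun o => k * f o) (k * a).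
Proof.
move=> fa; split; first by apply: measurable_funM => //; case: fa.
under eq_integral do rewrite EFinM.
by rewrite integralZl//; [rewrite fa.2|exact: has_mean_integrable fa].
Qed.

Lemma has_meanB f g a b :
  has_mean f a -> has_mean g b -> has_mean (fun o => f o - g o) (a - b).
Proof.
move=> fa /(has_meanZ (-1)) gb.
rewrite -mulN1r (_ : (fun o => _) = fun o => f o + -1 * g o).
  exact: has_meanD.
by apply/funext => o; rewrite mulN1r.
Qed.

Lemma has_mean_sum {I : finType} (f : I -> Omega -> R) (a : I -> R) :
  (forall i, has_mean (f i) (a i)) ->
  has_mean (fun o => \sum_i f i o) (\sum_i a i).
Proof.
move=> fa; split; first by apply: measurable_sum => i; case: (fa i).
under eq_integral do rewrite -sumEFin.
rewrite integral_sum//; last by move=> i; exact: has_mean_integrable (fa i).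
by rewrite -sumEFin; apply: eq_bigr => i _; case: (fa i).
Qed.

Lemma has_mean_le f g a b : has_mean f a -> has_mean g b ->
  (forall o, f o <= g o) -> a <= b.
Proof.
move=> fa gb fg; rewrite -lee_fin -fa.2 -gb.2; apply: le_integral => //.
- exact: has_mean_integrable fa.
- exact: has_mean_integrable gb.
- by move=> o _; rewrite lee_fin.
Qed.

Lemma eq_has_mean f g a : f =1 g -> has_mean f a -> has_mean g a.
Proof. by move=> /funext ->. Qed.

End Mean.
Arguments has_mean {R disp Omega} P f a.
Arguments has_meanD {R disp Omega P f g a b}.
Arguments has_meanB {R disp Omega P f g a b}.
Arguments has_meanZ {R disp Omega P} k {f a}.
Arguments has_mean_le {R disp Omega P f g a b}.

(** The cross term [- 2 * L] survives only where both indicators are one. Its loss where [iB] fails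
    is kept, since [L * (1 - iB)] will have a gap probability as mean; its loss where [iA] fails
    goes through Young's inequality, as [L] is controlled there only by its second moment. *)
Lemma square_bound {R : realType} (r L : R) (iA iB : bool) : 0 < r -> 0 <= L ->
  (L * iB%:R - iA%:R) ^+ 2 <=
  (1 + r) * L ^+ 2 - 2 * L + 1 + 2 * (L * (1 - iB%:R)) + r^-1 * (1 - iA%:R).
Proof.
move=> r0 L0.
have rV : 0 <= r^-1 by rewrite invr_ge0 ltW.
have rL : 0 <= r * L ^+ 2 by rewrite mulr_ge0 ?sqr_ge0 ?ltW.
have h : 2 * L <= r * L ^+ 2 + r^-1.
  have : 0 <= r^-1 * (r * L - 1) ^+ 2 by rewrite mulr_ge0 ?sqr_ge0.
  suff -> : r^-1 * (r * L - 1) ^+ 2 = r * L ^+ 2 + r^-1 - 2 * L by lra.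
  by field; rewrite gt_eqF.
have := sqr_ge0 L.
case: iA; case: iB => /=; nra.
Qed.

Section ChapmanRobbins.
Context {R : realType} {m : nat} {d : 'I_m -> nat} {n : nat}
  {disp : measure_display} {Omega : measurableType disp}
  {P : probability Omega R}.
Variables (s : R) (X : 'I_n -> Omega -> multi_index d)
  (xi : 'I_n -> {RV P >-> R}).
Hypotheses (s0 : s != 0) (sampling : uniform_gaussian_sampling s X xi).

Local Notation positions := (positions X).
Local Notation responses := (responses X xi).
Local Notation L := (likelihood s X xi).

(** The nonnegative case applies to positive and negative parts, which commute with multiplication
    by the nonnegative likelihood. *)
Lemma has_mean_change A B F a : sample_measurable F ->
  has_mean P (fun o => F (positions o) (responses B o)) a ->
  has_mean P (fun o => L A B o * F (positions o) (responses A o)) a.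
Proof.
move=> mF [_ Fa]; split.
  apply: measurable_funM; first exact: measurable_likelihood.
  exact: (measurable_sample s X xi).
rewrite -Fa integralE [in RHS]integralE.
have cm G : sample_measurable G -> (forall x y, 0 <= G x y) ->
  (\int[P]_o (L A B o * G (positions o) (responses A o))%:E =
   \int[P]_o (G (positions o) (responses B o))%:E)%E.
  by move=> mG G0; rewrite -(ge0_change_of_measure s X xi).
congr (_ - _)%E.
- transitivity (\int[P]_o (L A B o *
      Num.max (F (positions o) (responses A o)) 0)%:E)%E.
    apply: eq_integral => o _; rewrite funeposE -[0%E]/(0%:E) -EFin_max.
    by rewrite maxr_pMr ?likelihood_ge0// mulr0.
  rewrite (cm (fun x y => Num.max (F x y) 0)).
  + by apply: eq_integral => o _; rewrite funeposE -[0%E]/(0%:E) -EFin_max.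
  + by move=> x; apply: measurable_maxr => //; exact: mF.
  + by move=> x y; rewrite le_max lexx orbT.
- transitivity (\int[P]_o (L A B o *
      Num.max (- F (positions o) (responses A o)) 0)%:E)%E.
    apply: eq_integral => o _; rewrite funenegE -[0%E]/(0%:E) -EFinN -EFin_max.
    by rewrite maxr_pMr ?likelihood_ge0// mulr0 mulrN.
  rewrite (cm (fun x y => Num.max (- F x y) 0)).
  + apply: eq_integral => o _.
    by rewrite funenegE -[0%E]/(0%:E) -EFinN -EFin_max.
  + move=> x; apply: measurable_maxr => //.
    by apply: measurableT_comp => //; exact: mF.
  + by move=> x y; rewrite le_max lexx orbT.
Qed.

(* [theta] and [r] come from the weighted inequalities
   [2 g Z <= theta g ^ 2 + Z ^ 2 / theta], with [Z = L 1_SB - 1_SA], and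
   [2 L 1_(~SA) <= r L ^ 2 + 1_(~SA) / r]. *)
Lemma chapman_robbins (phi : estimator R d n) (A B I : tensor R d)
    (SA SB : set (tensor R d)) (p r theta : R) :
  measurable_estimator phi ->
  sample_measurable (fun x y => \1_SA (phi x y)) ->
  sample_measurable (fun x y => \1_SB (phi x y)) ->
  (forall w, \int[P]_o (estimate X xi phi A o w *
     \1_[set o' | SA (estimate X xi phi A o')] o)%:E = (A w)%:E)%E ->
  (forall w, \int[P]_o (estimate X xi phi B o w *
     \1_[set o' | SB (estimate X xi phi B o')] o)%:E = (B w)%:E)%E ->
  ((1 - p)%:E <= P [set o | SA (estimate X xi phi A o)])%E ->
  ((1 - p)%:E <= P [set o | SB (estimate X xi phi B o)])%E ->
  0 < r -> p <= r ^+ 2 -> 0 < theta ->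
  ((inner (B - A) I - `|inner A I| * p)%:E <=
   (theta / 2)%:E * mean_squared_error X xi phi A I +
   ((chi2 n s A B - 1 + 2 * p + r * (chi2 n s A B + 1)) / (2 * theta))%:E)%E.
Proof.
move=> mphi mSA mSB unA unB PA PB r0 pr th0.
have mI : sample_measurable (fun x y => inner (phi x y) I).
  move=> x; apply: measurable_sum => w; apply: measurable_funM; last exact: measurable_cst.
  exact: mphi x w.
have estE C : estimate X xi phi C = fun o => phi (positions o) (responses C o).
  by [].
have indicE' (S : set (tensor R d)) C o :
    \1_[set o' | S (estimate X xi phi C o')] o =
    \1_S (phi (positions o) (responses C o)) :> R.
  rewrite !indicE.
  suff -> : (o \in [set o' | S (estimate X xi phi C o')]) =
    (phi (positions o) (responses C o) \in S) by [].
  by apply/idP/idP; rewrite !inE.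
pose u (S : set (tensor R d)) x y : R := inner (phi x y) I * \1_S (phi x y).
have mean_u C S : sample_measurable (fun x y => \1_S (phi x y)) ->
    (forall w, \int[P]_o (estimate X xi phi C o w *
       \1_[set o' | S (estimate X xi phi C o')] o)%:E = (C w)%:E)%E ->
    has_mean P (fun o => u S (positions o) (responses C o)) (inner C I).
  move=> mS unC.
  apply: (@eq_has_mean _ _ _ _ (fun o => \sum_w I w *
     (phi (positions o) (responses C o) w * \1_S (phi (positions o) (responses C o))))).
    move=> o; rewrite /u /inner mulr_suml; apply: eq_bigr => w _; ring.
  rewrite /inner (eq_bigr (fun w => I w * C w)) => [|w _]; last exact: mulrC.
  apply: has_mean_sum => w; apply: has_meanZ; split.
    apply: (measurable_sample s X xi sampling
      (fun x y => phi x y w * \1_S (phi x y))).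
    by move=> x; apply: measurable_funM; [exact: mphi|exact: mS].
  by rewrite -unC; apply: eq_integral => o _; rewrite indicE'.
have mean_c C S : sample_measurable (fun x y => \1_S (phi x y)) ->
    ((1 - p)%:E <= P [set o | S (estimate X xi phi C o)])%E ->
    exists q, [/\ 0 <= q, q <= p &
      has_mean P (fun o => 1 - \1_S (phi (positions o) (responses C o))) q].
  move=> mS PS.
  have mE : measurable [set o | S (estimate X xi phi C o)].
    have : measurable_fun setT (fun o => \1_S (phi (positions o) (responses C o)) : R).
      exact: (measurable_sample s X xi _ (fun x y => \1_S (phi x y))).
    move=> /(_ measurableT [set 1] (measurable_set1 _)); rewrite setTI.
    suff -> : (fun o => \1_S (phi (positions o) (responses C o)) : R) @^-1` [set 1] =
       [set o | S (estimate X xi phi C o)] by [].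
    apply/seteqP; split=> o /=; rewrite indicE.
      have [|_] := boolP (_ \in S); first by rewrite inE.
      by move=> /eqP; rewrite eq_sym oner_eq0.
    by move=> So; rewrite mem_set.
  have PE : (P [set o | S (estimate X xi phi C o)] =
     (fine (P [set o | S (estimate X xi phi C o)]))%:E)%E.
    by rewrite fineK// fin_num_measure.
  exists (1 - fine (P [set o | S (estimate X xi phi C o)])); split.
  - by rewrite subr_ge0 -lee_fin -PE probability_le1.
  - by move: PS; rewrite PE lee_fin; lra.
  - apply: has_meanB; first exact: has_mean_cst.
    split; first exact: (measurable_sample s X xi _ (fun x y => \1_S (phi x y))).
    rewrite -PE -(setIT [set o | S (estimate X xi phi C o)]) -integral_indic//.
have [qA [qA0 qAp mean_cA]] := mean_c A SA mSA PA.
have [qB [qB0 qBp mean_cB]] := mean_c B SB mSB PB.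
have mean_uA := mean_u A SA mSA unA.
have mean_uB := has_mean_change A B (u SB) _ 
  (fun x => measurable_funM (mI x) (mSB x)) (mean_u B SB mSB unB).
have mean_LcB := has_mean_change A B (fun x y => 1 - \1_SB (phi x y)) _
  (fun x => measurable_funB (measurable_cst _) (mSB x)) mean_cB.
have mean_L : has_mean P (L A B) 1.
  apply: (@eq_has_mean _ _ _ _ (fun o => L A B o * 1)); first by move=> o; rewrite mulr1.
  apply: (has_mean_change A B (fun _ _ => 1)); first by move=> x; exact: measurable_cst.
  exact: has_mean_cst.
have mean_L2 : has_mean P (fun o => L A B o ^+ 2) (chi2 n s A B).
  split; last exact: integral_likelihood_sqr.
  by apply: measurable_funX; exact: measurable_likelihood.
have mg : measurable_fun setT (fun o =>
    (inner (estimate X xi phi A o) I - inner A I) ^+ 2).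
  apply: (measurable_sample s X xi _ (fun x y => (inner (phi x y) I - inner A I) ^+ 2)) => //.
  by move=> x; apply: measurable_funX; apply: measurable_funB => //; exact: mI.
have [->|mse_fin] := eqVneq (mean_squared_error X xi phi A I) +oo%E.
  by rewrite gt0_muley ?lte_fin ?divr_gt0// addye// leey.
have mse_ge0 : (0 <= mean_squared_error X xi phi A I)%E.
  by apply: integral_ge0 => o _; rewrite lee_fin sqr_ge0.
have mseE : (mean_squared_error X xi phi A I =
    (fine (mean_squared_error X xi phi A I))%:E)%E.
  by rewrite fineK// ge0_fin_numE// lt_neqAle mse_fin leey.
have mean_g : has_mean P (fun o => (inner (estimate X xi phi A o) I - inner A I) ^+ 2)
  (fine (mean_squared_error X xi phi A I)) by split.
rewrite mseE -EFinM -EFinD lee_fin.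
set mse := fine _ in mean_g *.
set chi := chi2 n s A B in mean_L2 *.
set a := inner A I in mean_uA mean_g *.
(* This integrates a pointwise inequality. With [g] the estimated form and [Z = L 1_SB - 1_SA], the
   integrand on the left is [(g - a) Z + a Z]. The first summand is bounded by Young's inequality
   and [square_bound]; the second is rewritten through the complements, whose means are [qA] and
   [qB]. *)
have key : inner B I - a <= theta / 2 * mse + (2 * theta)^-1 *
   ((1 + r) * chi - 2 * 1 + 1 + 2 * qB + r^-1 * qA) + a * (1 - 1 - qB + qA).
  apply: has_mean_le (has_meanB mean_uB mean_uA) _ _.
    apply: has_meanD; last first.
      apply: has_meanZ; apply: has_meanD mean_cA.
      exact: has_meanB (has_meanB mean_L (has_mean_cst 1)) mean_LcB.
    apply: has_meanD (has_meanZ _ mean_g) _.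
    apply: has_meanZ; apply: has_meanD; last exact: has_meanZ mean_cA.
    apply: has_meanD; last exact: has_meanZ mean_LcB.
    apply: has_meanD; last exact: has_mean_cst 1.
    exact: has_meanB (has_meanZ _ mean_L2) (has_meanZ _ mean_L).
  move=> o /=; rewrite /u estE.
  set g := inner (phi _ _) I; set l := L A B o.
  rewrite !indicE; set iA := _ \in SA; set iB := _ \in SB.
  have := square_bound r l iA iB r0 (likelihood_ge0 s X xi A B o).
  set Q := (X in _ <= X) => HQ.
  have : 0 <= (2 * theta)^-1 * (theta * (g - a) - (l * iB%:R - iA%:R)) ^+ 2.
    by rewrite mulr_ge0 ?sqr_ge0// invr_ge0 mulr_ge0// ltW.
  have -> : (2 * theta)^-1 * (theta * (g - a) - (l * iB%:R - iA%:R)) ^+ 2 =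
    theta / 2 * (g - a) ^+ 2 + (2 * theta)^-1 * (l * iB%:R - iA%:R) ^+ 2
     - (g - a) * (l * iB%:R - iA%:R).
    by field; rewrite gt_eqF.
  have : (2 * theta)^-1 * (l * iB%:R - iA%:R) ^+ 2 <= (2 * theta)^-1 * Q.
    by rewrite ler_wpM2l// invr_ge0 mulr_ge0// ltW.
  have -> : a * (l - 1 - l * (1 - iB%:R) + (1 - iA%:R)) = a * (l * iB%:R - iA%:R).
    by ring.
  have -> : l * (g * iB%:R) - g * iA%:R =
      (g - a) * (l * iB%:R - iA%:R) + a * (l * iB%:R - iA%:R) by ring.
  rewrite -/Q; clearbody Q; lra.
have -> : inner (B - A) I = inner B I - a.
  rewrite /a /inner -sumrB; apply: eq_bigr => w _; rewrite !ffunE; ring.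
have h1 : a * (1 - 1 - qB + qA) <= `|a| * p.
  apply: le_trans (ler_norm _) _; rewrite normrM ler_wpM2l//.
  by rewrite ler_norml; apply/andP; split; lra.
(* Here [p <= r ^ 2] enters: both halves of the Young bound are then of order [r]. *)
have h2 : r^-1 * qA <= r.
  by rewrite mulrC ler_pdivrMr// -expr2; lra.
have h3 : (2 * theta)^-1 * ((1 + r) * chi - 2 * 1 + 1 + 2 * qB + r^-1 * qA) <=
   (chi - 1 + 2 * p + r * (chi + 1)) / (2 * theta).
  rewrite mulrC ler_wpM2r//; last lra.
  by rewrite invr_ge0 mulr_ge0// ltW.
lra.
Qed.

End ChapmanRobbins.

(** * Rank-one tensors *)

(** The distributive law for factors indexed by different types; dependent functions are handled as
    functions into tagged values. *)
Lemma sum_multi_index {R : realType} {K : finType} {d : K -> nat}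
    (F : forall k, 'I_(d k) -> R) :
  \sum_(w : multi_index d) \prod_k F k (w k) = \prod_k \sum_i F k i.
Proof.
have E k : \sum_i F k i = \sum_(j in tagged_with (fun k => 'I_(d k)) k) untag 0 (F k) j.
  exact: big_tag.
rewrite [RHS](eq_bigr _ (fun k _ => E k)) bigA_distr_big_dep.
rewrite (reindex (@dffun_of_fprod K (fun k => 'I_(d k)))); last first.
  exact/onW_bij/dffun_of_fprod_bij.
have := @big_fprod R 0 1 *%R +%R K (fun k => 'I_(d k)) (fun k => [ffun i => F k i]).
rewrite /=.
move=> H.
rewrite (eq_bigr (fun t : fprod (fun k => 'I_(d k)) => \prod_(i in K) [ffun i0 => F i i0] (t i))).
  rewrite H; apply: eq_bigr => g /familyP gf; apply: eq_bigr => k _.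
  by have := gf k; case: (g k) => k' x /eqP /= ek; subst; rewrite !untagE ffunE.
by move=> t _; apply: eq_bigr => k _; rewrite !ffunE.
Qed.

Lemma prod_other {R : realType} {m : nat} (j : 'I_m) (f : 'I_m -> R) :
  \prod_(k : other j) f (val k) = \prod_(k | k != j) f k.
Proof. by rewrite [RHS](big_sub [pred k | k != j] f). Qed.

(** Supplies the single term of the sum that defines [unfold]. *)
Lemma ex_insert_mode {m : nat} (d : 'I_m -> nat) (j : 'I_m) (i : 'I_(d j))
    (c : multi_index (@other_dims m d j)) :
  exists w : multi_index d, w j = i /\ drop_mode j w = c.
Proof.
have [f Hf] : exists f : forall k, 'I_(d k), forall k,
    (forall e : j = k, f k = ecast k ('I_(d k)) e i) /\
    (forall h : k != j, f k = c (exist (fun k => k != j) k h)).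
  apply: (fin_all_exists (U := fun k => 'I_(d k)) (P := fun k y =>
   (forall e : j = k, y = ecast k ('I_(d k)) e i) /\
    (forall h : k != j, y = c (exist (fun k => k != j) k h)))).
  move=> k; case: (j =P k) => [e|/eqP ne].
    subst k; exists i; split; first by move=> e; rewrite eq_axiomK.
    by move=> h; exfalso; rewrite eqxx in h.
  have h : k != j by rewrite eq_sym.
  exists (c (exist (fun k => k != j) k h)); split.
    by move=> e; exfalso; rewrite e eqxx in ne.
  by move=> h'; rewrite (bool_irrelevance h h').
exists [ffun k => f k]; split; first by rewrite ffunE (proj1 (Hf j) erefl).
by apply/ffunP => -[k h]; rewrite !ffunE /= (proj2 (Hf k) h).
Qed.

(** The scalar is kept apart so that the vectors can be normalised: for unit vectors and [c != 0],
    the absolute value of [c] is the only nonzero singular value of each unfolding. *)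
Definition rank1 {R : realType} {m : nat} {d : 'I_m -> nat} (c : R)
    (x : forall j, 'I_(d j) -> R) : tensor R d :=
  [ffun w : multi_index d => c * \prod_j x j (w j)].
Arguments rank1 {R m d} c x : simpl never.

Section RankOne.
Context {R : realType} {m : nat} {d : 'I_m -> nat}.
Implicit Types (A B : tensor R d) (c : R) (x y : forall j, 'I_(d j) -> R).

Definition dotv {n : nat} (p q : 'I_n -> R) : R := \sum_i p i * q i.

Lemma inner_rank1 c c' x y :
  inner (rank1 c x) (rank1 c' y) = c * c' * \prod_j dotv (x j) (y j).
Proof.
rewrite /dotv -(sum_multi_index (fun j i => x j i * y j i)) mulr_sumr.
apply: eq_bigr => w _; rewrite !ffunE big_split/=; ring.
Qed.

Lemma unfold_rank1 c x j i a :
  unfold j (rank1 c x) i a =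
  c * x j i * \prod_(k : other j) x (val k) (enum_val a k).
Proof.
rewrite mxE; have [w [wi wc]] := ex_insert_mode d j i (enum_val a).
rewrite (big_pred1 w) => [|v] /=; last first.
  apply/andP/eqP => [[/eqP vi /eqP va]|->]; last by rewrite wi wc.
  apply/ffunP => k; have [->|kj] := eqVneq k j; first by rewrite vi wi.
  have : drop_mode j v = drop_mode j w by rewrite va wc.
  by move/ffunP/(_ (exist (fun k => k != j) k kj)); rewrite !ffunE.
rewrite ffunE (bigD1 j)//= -prod_other wi mulrA; congr (_ * _).
apply: eq_bigr => k _; rewrite -wc ffunE; by [].
Qed.

Lemma sum_unfold_other A x j i :
  \sum_a unfold j A i a * \prod_(k : other j) x (val k) (enum_val a k) =
  \sum_(w : multi_index d | w j == i) A w * \prod_(k | k != j) x k (w k).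
Proof.
rewrite [RHS](partition_big (fun w : multi_index d => enum_rank (drop_mode j w)) predT)//=.
apply: eq_bigr => a _; rewrite mxE mulr_suml.
apply: eq_big => [w|w /andP[_ /eqP wa]].
  by congr (_ && _); apply/eqP/eqP => [->|<-]; rewrite ?enum_valK ?enum_rankK.
rewrite -prod_other; congr (_ * _); apply: eq_bigr => k _.
by rewrite -wa ffunE.
Qed.

(** Turns contractions of an unfolding, as they occur in the tangent factor, into inner products
    with a rank-one tensor whose [j]-th vector is [v]. *)
Lemma sum_unfold_dot A x j (v : 'I_(d j) -> R) :
  \sum_i v i * (\sum_a unfold j A i a * \prod_(k : other j) x (val k) (enum_val a k)) =
  \sum_w A w * (v (w j) * \prod_(k | k != j) x k (w k)).
Proof.
rewrite [RHS](partition_big (fun w : multi_index d => w j) predT)//=.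
apply: eq_bigr => i _; rewrite sum_unfold_other mulr_sumr.
by apply: eq_bigr => w /eqP ->; rewrite mulrCA.
Qed.

Lemma prod_dfwith x j (v : 'I_(d j) -> R) (w : multi_index d) :
  \prod_k eqtype.dfwith x v k (w k) = v (w j) * \prod_(k | k != j) x k (w k).
Proof.
rewrite (bigD1 j)//= eqtype.dfwith_in; congr (_ * _); apply: eq_bigr => k kj.
by rewrite eqtype.dfwith_out// eq_sym.
Qed.

End RankOne.

(** * Rank, singular values and tangent factors in the rank-one model *)

Section Model.
Context {R : realType} {m : nat} {d : 'I_m -> nat}.
Implicit Types (A B : tensor R d) (c : R) (x y : forall j, 'I_(d j) -> R).

Definition core_index : multi_index (@rank_one m) := [ffun=> ord0].

Lemma core_indexE (v : multi_index (@rank_one m)) : v = core_index.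
Proof. by apply/ffunP => k; rewrite ffunE; apply: ord1. Qed.

Definition colv (U : forall j, 'M[R]_(d j, rank_one j)) j (i : 'I_(d j)) : R :=
  U j i (ord0 : 'I_1).

Lemma tucker_rank1 (C : tensor R (@rank_one m)) U :
  tucker C U = rank1 (C core_index) (colv U).
Proof.
apply/ffunP => w; rewrite !ffunE (big_pred1 core_index) => [|v]; last first.
  by apply/esym/eqP; exact: core_indexE.
by congr (_ * _); apply: eq_bigr => j _; rewrite ffunE.
Qed.

Lemma colv_unit (U : forall j, 'M[R]_(d j, rank_one j)) j :
  (U j)^T *m U j = 1%:M -> dotv (colv U j) (colv U j) = 1.
Proof.
move=> /matrixP/(_ (ord0 : 'I_1) (ord0 : 'I_1)); rewrite !mxE eqxx mulr1n => <-.
by apply: eq_bigr => i _; rewrite mxE.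
Qed.

Lemma two_inf_colv (U : forall j, 'M[R]_(d j, rank_one j)) j i :
  `|colv U j i| <= two_inf (U j).
Proof.
rewrite /two_inf; apply: le_trans (le_bigmax _ _ i).
rewrite (big_ord_recl 0)/= big_ord0 addr0 sqrtr_sqr; exact: lexx.
Qed.

Definition colmx x j : 'M[R]_(d j, rank_one j) := \matrix_(i, _) x j i.

Lemma colv_colmx x : colv (colmx x) = x.
Proof. by apply: functional_extensionality_dep => j; apply/funext => i; rewrite /colv mxE. Qed.

(** The unfolding is an outer product, so its rank is at most one; contracting it with all the [x k]
    returns [c], so it is nonzero. *)
Lemma rank_unfold_rank1 c x j : c != 0 ->
  (forall k, dotv (x k) (x k) = 1) -> \rank (unfold j (rank1 c x)) = 1%N.
Proof.
move=> c0 x1; apply/eqP; rewrite eqn_leq; apply/andP; split.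
  have -> : unfold j (rank1 c x) = (\col_i x j i) *m
      (\row_(a < #|multi_index (@other_dims m d j)|)
        (c * \prod_(k : other j) x (val k) (enum_val a k))).
    apply/matrixP => i a; rewrite unfold_rank1 mxE big_ord1 !mxE; ring.
  exact: leq_trans (mxrankM_maxl _ _) (rank_leq_col _).
rewrite lt0n mxrank_eq0; apply: contraNneq c0 => uz.
have := sum_unfold_dot (rank1 c x) x j (x j).
rewrite uz [X in X = _]big1 => [/esym/eqP|i _]; last first.
  by rewrite big1 ?mulr0// => a _; rewrite mxE mul0r.
rewrite (eq_bigr (fun w => rank1 c x w * rank1 1 x w)).
  rewrite -/(inner _ _) inner_rank1 mulr1 big1 ?mulr1// => k _; exact: x1.
by move=> w _; rewrite [rank1 1 x w]ffunE mul1r [in RHS](bigD1 j).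
Qed.

Lemma incoherent_model_rank1 (mu c : R) x : c != 0 ->
  (forall k, dotv (x k) (x k) = 1) ->
  (forall j i, `|x j i| <= Num.sqrt (mu / (d j)%:R)) ->
  incoherent_model mu (@rank_one m) (rank1 c x).
Proof.
move=> c0 x1 xmu; exists [ffun=> c], (colmx x); split.
  split.
  - move=> j; apply/matrixP => a b; rewrite !ord1 !mxE eqxx -(x1 j).
    by apply: eq_bigr => i _; rewrite !mxE.
  - by rewrite tucker_rank1 ffunE colv_colmx.
  - by move=> j; rewrite rank_unfold_rank1.
move=> j; rewrite /two_inf; apply/bigmax_leP; split; first exact: sqrtr_ge0.
move=> i _; rewrite (big_ord_recl 0)/= big_ord0 addr0 sqrtr_sqr mxE.
by rewrite mulr1; exact: xmu.
Qed.

(** Every Gram matrix is [c ^ 2] times the projection on [x j], whose only nonzero eigenvalue is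
    [c ^ 2]. The mode [j0] witnesses that there is an unfolding at all. *)
Lemma nonzero_singular_values_rank1 c x (j0 : 'I_m) : c != 0 ->
  (forall k, dotv (x k) (x k) = 1) ->
  nonzero_singular_values (rank1 c x) = [set `|c|].
Proof.
move=> c0 x1.
have G j : unfold j (rank1 c x) *m (unfold j (rank1 c x))^T =
    \matrix_(i, i') (c ^+ 2 * (x j i * x j i')).
  apply/matrixP => i i'; rewrite [LHS]mxE [RHS]mxE.
  transitivity (\sum_(a < #|multi_index (@other_dims m d j)|)
     c ^+ 2 * (x j i * x j i') * \prod_(k : other j)
       (x (val k) (enum_val a k) * x (val k) (enum_val a k))).
    apply: eq_bigr => a _; rewrite [X in _ * X]mxE !unfold_rank1 big_split/=; ring.
  rewrite -mulr_sumr -[RHS]mulr1; congr (_ * _).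
  transitivity (\sum_(v : multi_index (@other_dims m d j)) \prod_(k : other j)
       (x (val k) (v k) * x (val k) (v k))).
    by rewrite [RHS](reindex _ (onW_bij _ (enum_val_bij _))).
  rewrite (sum_multi_index (d := @other_dims m d j)
    (fun k i => x (val k) i * x (val k) i)) big1// => k _.
  exact: x1 (val k).
have xn0 j : \row_i x j i != 0.
  apply/eqP => /rowP x0; have := x1 j; rewrite /dotv big1 => [/eqP|i _].
    by rewrite eq_sym oner_eq0.
  by have := x0 i; rewrite !mxE => ->; rewrite mul0r.
apply/seteqP; split=> s /=.
  move=> [s0 [j /eigenvalueP [v Hv vn0]]].
  set q := \sum_i v 0 i * x j i.
  have vE l : s ^+ 2 * v 0 l = c ^+ 2 * q * x j l.
    have /rowP/(_ l) := Hv; rewrite mxE [RHS]mxE => <-.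
    rewrite /q -mulrA mulr_suml mulr_sumr; apply: eq_bigr => i _.
    rewrite G mxE; ring.
  have qE : s ^+ 2 * q = c ^+ 2 * q.
    rewrite {1}/q mulr_sumr (eq_bigr (fun i => c ^+ 2 * q * (x j i * x j i))).
      by rewrite -mulr_sumr -/(dotv (x j) (x j)) x1 mulr1.
    by move=> i _; rewrite [LHS]mulrA vE -mulrA.
  have q0 : q != 0.
    apply: contraNneq vn0 => q0; apply/eqP/rowP => l; rewrite mxE.
    have /eqP := vE l; rewrite q0 mulr0 mul0r mulf_eq0 sqrf_eq0 gt_eqF//=.
    by move/eqP.
  have /eqP := mulIf q0 qE; rewrite eqf_sqr => /orP[] /eqP sc.
    by rewrite -sc gtr0_norm.
  by rewrite -normrN -sc gtr0_norm.
move=> ->; split; first by rewrite normr_gt0.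
exists j0; apply/eigenvalueP; exists (\row_i x j0 i) => //.
apply/rowP => l; rewrite mxE !mxE real_normK ?num_real//.
rewrite (eq_bigr (fun i => c ^+ 2 * x j0 l * (x j0 i * x j0 i))).
  by rewrite -mulr_sumr -/(dotv (x j0) (x j0)) x1 mulr1.
move=> i _; rewrite G !mxE; ring.
Qed.

Lemma lambda_min_rank1 c x (j0 : 'I_m) : c != 0 ->
  (forall k, dotv (x k) (x k) = 1) -> lambda_min (rank1 c x) = `|c|.
Proof.
by move=> c0 x1; rewrite /lambda_min (nonzero_singular_values_rank1 c x j0)// inf1.
Qed.

Lemma lambda_max_rank1 c x (j0 : 'I_m) : c != 0 ->
  (forall k, dotv (x k) (x k) = 1) -> lambda_max (rank1 c x) = `|c|.
Proof.
by move=> c0 x1; rewrite /lambda_max (nonzero_singular_values_rank1 c x j0)// sup1.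
Qed.

Lemma mp_inverse_outer p q (A : 'M[R]_(p, q)) :
  mp_inverse A *m A *m mp_inverse A = mp_inverse A.
Proof.
rewrite /mp_inverse; case: xgetP => [B _ [] //|_].
by rewrite mulmx0.
Qed.

(* The equation [b * c * b = b] is what remains of the Penrose equation
   [B A B = B]; it also holds for [b = 0], the default value of [mp_inverse], so
   the existence of the pseudo-inverse is never needed. *)
Lemma tangent_factorE (C : tensor R (@rank_one m)) (U : forall j, 'M[R]_(d j, rank_one j))
    A j : (U j)^T *m U j = 1%:M ->
  exists2 b : R, b * C core_index * b = b & 
  let z i := \sum_a unfold j A i a *
               \prod_(k : other j) colv U (val k) (enum_val a k) in
  forall i, tangent_factor C U A j i (ord0 : 'I_1) =
    b * (z i - dotv (colv U j) z * colv U j i).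
Proof.
move=> Uj; set B := mp_inverse (unfold j C).
(* [B] has a single row, but its row index is the cardinality of a type of multi-indices; summing
   over it avoids a cast. *)
pose b := \sum_a B a (ord0 : 'I_1).
have unfC i a : unfold j C i a = C core_index.
  rewrite mxE (big_pred1 core_index) // => v /=.
  rewrite [v]core_indexE eqxx; apply/andP; split; apply/eqP.
    by rewrite [LHS]ord1 [RHS]ord1.
  by apply/ffunP => k; rewrite [LHS]ord1 [RHS]ord1.
exists b.
  have BAB a : B a (ord0 : 'I_1) = B a (ord0 : 'I_1) * C core_index * b.
    have /matrixP/(_ a (ord0 : 'I_1)) := mp_inverse_outer _ _ (unfold j C).
    rewrite -/B => {1}<-; rewrite mxE mulr_sumr; apply: eq_bigr => a' _.
    by rewrite mxE (big_ord_recl 0)/= big_ord0 addr0 unfC.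
  by rewrite {3}/b (eq_bigr _ (fun a _ => BAB a)) -!mulr_suml.
move=> z i; rewrite /tangent_factor.
have ZB : unfold j A *m kron_others U j *m B =
    \matrix_(i, _) (b * z i).
  apply/matrixP => i' l; rewrite [LHS]mxE [RHS]mxE mulrC mulr_sumr.
  apply: eq_bigr => a _; rewrite [l]ord1; congr (_ * _).
  rewrite mxE; apply: eq_bigr => a' _; congr (_ * _).
  rewrite mxE; apply: eq_bigr => k _; congr (U _ _ _).
  by rewrite [LHS]ord1 [RHS]ord1.
rewrite -!mulmxA [X in _ *m X]mulmxA ZB mulmxBl mul1mx !mxE mulrBr; congr (_ - _).
rewrite /dotv mulr_suml mulr_sumr; apply: eq_bigr => i' _.
rewrite !mxE (big_ord_recl 0)/= big_ord0 addr0 !mxE /colv; ring.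
Qed.

End Model.

(** * The tangent direction and a curve in the model *)

Section Inner.
Context {R : realType} {m : nat} {d : 'I_m -> nat}.
Implicit Types (A B E : tensor R d).

Lemma innerC A B : inner A B = inner B A.
Proof. by apply: eq_bigr => w _; rewrite mulrC. Qed.

Lemma innerDl A B E : inner (A + B) E = inner A E + inner B E.
Proof. by rewrite -big_split; apply: eq_bigr => w _; rewrite ffunE mulrDl. Qed.

Lemma innerDr A B E : inner E (A + B) = inner E A + inner E B.
Proof. by rewrite innerC innerDl !(innerC _ E). Qed.

Lemma inner_suml (I : finType) (F : I -> tensor R d) E :
  inner (\sum_i F i) E = \sum_i inner (F i) E.
Proof.
rewrite exchange_big; apply: eq_bigr => w _.
by rewrite sum_ffunE mulr_suml.
Qed.

Lemma inner_sumr (I : finType) (F : I -> tensor R d) E :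
  inner E (\sum_i F i) = \sum_i inner E (F i).
Proof. by rewrite innerC inner_suml; apply: eq_bigr => i _; rewrite innerC. Qed.

Lemma sqr_frob A : frob A ^+ 2 = inner A A.
Proof.
rewrite /frob sqr_sqrtr; last by apply: sumr_ge0 => w _; rewrite sqr_ge0.
by apply: eq_bigr => w _; rewrite expr2.
Qed.

Lemma frob_ge0 A : 0 <= frob A. Proof. exact: sqrtr_ge0. Qed.

Lemma inner_le_l1norm A B (e : R) : (forall w, `|A w| <= e) ->
  `|inner A B| <= e * l1norm B.
Proof.
move=> Ae; apply: le_trans (ler_norm_sum _ _ _) _.
rewrite /l1norm mulr_sumr; apply: ler_sum => w _.
by rewrite normrM ler_wpM2r.
Qed.

End Inner.

Lemma dotv_ge0 {R : realType} {n : nat} (p : 'I_n -> R) : 0 <= dotv p p.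
Proof. by apply: sumr_ge0 => i _; rewrite -expr2 sqr_ge0. Qed.

Lemma sqr_le_dotv {R : realType} {n : nat} (p : 'I_n -> R) i :
  p i ^+ 2 <= dotv p p.
Proof.
rewrite /dotv (bigD1 i)//= expr2 lerDl.
by apply: sumr_ge0 => k _; rewrite -expr2 sqr_ge0.
Qed.

Section Tangent.
Context {R : realType} {m : nat} {d : 'I_m -> nat}.
Implicit Types (A B : tensor R d).

Lemma tucker_proj (U : forall j, 'M[R]_(d j, rank_one j)) A :
  tucker A (fun j => Defs.proj (U j)) = rank1 (inner A (rank1 1 (colv U))) (colv U).
Proof.
apply/ffunP => w; rewrite !ffunE /inner mulr_suml; apply: eq_bigr => v _.
rewrite ffunE mul1r -mulrA; congr (_ * _); rewrite -big_split/=.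
apply: eq_bigr => j _; rewrite mxE (big_ord_recl 0)/= big_ord0 addr0 mxE.
by rewrite mulrC.
Qed.

Lemma tucker_dfwith (C : tensor R (@rank_one m))
    (U : forall j, 'M[R]_(d j, rank_one j)) j (W : 'M[R]_(d j, rank_one j)) :
  tucker C (eqtype.dfwith U W) =
  rank1 (C core_index) (eqtype.dfwith (colv U) (fun i => W i (ord0 : 'I_1))).
Proof.
rewrite tucker_rank1; apply/ffunP => w; rewrite !ffunE; congr (_ * _).
apply: eq_bigr => k _; case: (j =P k) => [e|/eqP jk].
  by subst k; rewrite /colv !eqtype.dfwith_in.
by rewrite /colv !eqtype.dfwith_out.
Qed.

(** As each [w j] is orthogonal to [u j], the summands of [H] are pairwise orthogonal and Pythagoras
    gives the norm. Pairing [A] with a summand returns the squared norm of that summand, which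
    yields the projection identity [inner A H = inner H H]. *)
Lemma tangent_decomp (C : tensor R (@rank_one m))
    (U : forall j, 'M[R]_(d j, rank_one j)) A :
  (forall j, (U j)^T *m U j = 1%:M) ->
  let u := colv U in let c := C core_index in let H := proj_tangent C U A in
  exists (a : R) (w : forall j, 'I_(d j) -> R),
  [/\ forall v, H v = a * (\prod_j u j (v j)) +
        \sum_j c * (w j (v j) * \prod_(k | k != j) u k (v k)),
      forall j, dotv (u j) (w j) = 0,
      inner A H = inner H H &
      inner H H = a ^+ 2 + \sum_j c ^+ 2 * dotv (w j) (w j)].
Proof.
move=> U1 u c H.
pose a := inner A (rank1 1 u).
pose w j i : R := tangent_factor C U A j i (ord0 : 'I_1).
have HE : H = rank1 a u + \sum_j rank1 c (eqtype.dfwith u (w j)).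
  rewrite /H /proj_tangent tucker_proj; congr (_ + _).
  by apply: eq_bigr => j _; rewrite tucker_dfwith.
have u1 j : dotv (u j) (u j) = 1 by exact: colv_unit.
have wz j : exists (b : R) (z : 'I_(d j) -> R), [/\ b * c * b = b,
    forall i, w j i = b * (z i - dotv (u j) z * u j i) &
    inner A (rank1 c (eqtype.dfwith u (w j))) = c * dotv (w j) z].
  have [b bcb wE] := tangent_factorE C U A j (U1 j).
  exists b, (fun i => \sum_a0 unfold j A i a0 *
               \prod_(k : other j) u (val k) (enum_val a0 k)); split => //.
  rewrite /dotv (sum_unfold_dot A u j (w j)) mulr_sumr; apply: eq_bigr => v _.
  by rewrite ffunE prod_dfwith mulrCA.
have uw j : dotv (u j) (w j) = 0.
  have [b [z [_ wE _]]] := wz j.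
  rewrite /dotv (eq_bigr (fun i => b * (u j i * z i) -
      b * dotv (u j) z * (u j i * u j i))); last first.
    by move=> i _; rewrite wE; ring.
  by rewrite sumrB -!mulr_sumr -/(dotv (u j) (u j)) u1 mulr1 /dotv subrr.
have dfE j k : dotv (u k) (eqtype.dfwith u (w j) k) = (j != k)%:R.
  case: (j =P k) => [e|/eqP jk]; first by subst k; rewrite eqtype.dfwith_in uw.
  by rewrite eqtype.dfwith_out// u1.
have cross j : inner (rank1 a u) (rank1 c (eqtype.dfwith u (w j))) = 0.
  by rewrite inner_rank1 (bigD1 j)//= dfE eqxx mul0r mulr0.
have diag j k : inner (rank1 c (eqtype.dfwith u (w j)))
    (rank1 c (eqtype.dfwith u (w k))) =
    if j == k then c ^+ 2 * dotv (w j) (w j) else 0.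
  rewrite inner_rank1; case: (j =P k) => [e|/eqP jk].
    subst k; rewrite (bigD1 j)//= eqtype.dfwith_in big1 ?mulr1 ?expr2// => k kj.
    by rewrite eqtype.dfwith_out 1?eq_sym// u1.
  rewrite (bigD1 k)//= eqtype.dfwith_in eqtype.dfwith_out// uw.
  by rewrite mul0r mulr0.
have HH : inner H H = a ^+ 2 + \sum_j c ^+ 2 * dotv (w j) (w j).
  rewrite HE innerDl !innerDr inner_sumr (eq_bigr _ (fun j _ => cross j)).
  rewrite big1_eq addr0 inner_rank1 big1 ?mulr1 => [|j _]; last exact: u1.
  rewrite expr2; congr (_ + _); rewrite !inner_suml.
  rewrite (eq_bigr (fun=> 0)) => [|j _]; last by rewrite innerC cross.
  rewrite big1_eq add0r; apply: eq_bigr => j _; rewrite inner_sumr.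
  rewrite (eq_bigr _ (fun k _ => diag j k)) (bigD1 j)//= eqxx big1 ?addr0//.
  by move=> k kj; rewrite eq_sym (negbTE kj).
exists a, w; split => //.
- move=> v; rewrite HE ffunE sum_ffunE ffunE; congr (_ + _).
  by apply: eq_bigr => j _; rewrite ffunE prod_dfwith.
- rewrite HH HE innerDr inner_sumr; congr (_ + _).
    rewrite expr2 {2}/a /inner mulr_sumr; apply: eq_bigr => v _.
    by rewrite !ffunE mul1r mulrCA.
  apply: eq_bigr => j _; have [b [z [bcb wE ->]]] := wz j.
  have -> : dotv (w j) (w j) = b * dotv (w j) z.
    transitivity (b * dotv (w j) z - b * dotv (u j) z * dotv (u j) (w j)).
      have wE' i : w j i = b * (z i - dotv (u j) z * u j i) by [].
      move: wE'; move: (dotv (u j) z) => q wE'.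
      rewrite /dotv !mulr_sumr -sumrB; apply: eq_bigr => i _.
      by rewrite {2}wE'; ring.
    by rewrite uw mulr0 subr0.
  rewrite mulrA; have -> : dotv (w j) z = b * dotv (fun i => z i - dotv (u j) z * u j i) z.
    by rewrite /dotv mulr_sumr; apply: eq_bigr => i _; rewrite wE mulrA.
  set Y := dotv _ z.
  (* Only [b * c * b = b] is available here, and it suffices even for [b = 0]. *)
  have -> : c ^+ 2 * b * (b * Y) = c * ((b * c * b) * Y) by ring.
  by rewrite bcb.
Qed.

End Tangent.

(* Splitting off one factor, a product of perturbed factors minus its
   first-order expansion satisfies r' <= 2 r + n eta ^ 2. *)
Lemma prod_remainder {R : realType} {I : eqType} (s : seq I) (x y : I -> R)
    (eta : R) : uniq s -> 0 <= eta <= 1 ->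
  (forall i, `|x i| <= 1) -> (forall i, `|y i| <= eta) ->
  `|\prod_(i <- s) (x i + y i) - \prod_(i <- s) x i -
    \sum_(j <- s) y j * \prod_(k <- s | k != j) x k| <=
  4 ^+ size s * eta ^+ 2.
Proof.
move=> us /andP[eta0 eta1] x1 yeta.
have prodx (q : seq I) (Q : pred I) : `|\prod_(i <- q | Q i) x i| <= 1.
  by rewrite normr_prod; apply: prodr_ile1 => i _; rewrite normr_ge0 x1.
pose D q := \sum_(j <- q) y j * \prod_(k <- q | k != j) x k.
have Dle q : `|D q| <= (size q)%:R * eta.
  apply: le_trans (ler_norm_sum _ _ _) _.
  apply: le_trans (ler_sum _ (fun i _ => _ : _ <= eta)) _.
    by move=> i _; rewrite normrM -[leRHS]mulr1 ler_pM.
  by rewrite big_const_seq count_predT iter_addr addr0 mulr_natl.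
rewrite -/(D s); elim: s us => [|j q IH] /=.
  by rewrite !big_nil /D big_nil !subr0 subrr normr0 mulr_ge0 ?sqr_ge0.
move=> /andP[jq uq]; have {}IH := IH uq.
rewrite !big_cons.
have -> : D (j :: q) = y j * \prod_(i <- q) x i + x j * D q.
  rewrite /D big_cons big_cons eqxx /=; congr (_ * _ + _).
    rewrite [RHS]big_seq [LHS]big_seq_cond; apply: eq_bigl => i.
    by have [iq|//] := boolP (i \in q); rewrite /=; apply: contraNneq jq => <-.
  rewrite mulr_sumr [LHS]big_seq [RHS]big_seq; apply: eq_bigr => i iq.
  rewrite big_cons; have -> : j != i by apply: contraNneq jq => ->.
  by rewrite mulrCA.
set p := \prod_(i <- q) (x i + y i) in IH *.
set p0 := \prod_(i <- q) x i in IH *.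
set e := p - p0 - D q in IH.
have -> : (x j + y j) * p - x j * p0 - (y j * p0 + x j * D q) =
    x j * e + y j * (e + D q) by rewrite /e; ring.
(* The base 4 closes the recursion, since [2 * 4 ^ n + n <= 4 ^ n.+1]. *)
have Hn : ((size q)%:R : R) <= 4 ^+ size q.
  by rewrite -natrX ler_nat ltnW// ltn_expl.
apply: le_trans (ler_normD _ _) _; rewrite !normrM.
have h1 : `|x j| * `|e| <= `|e| by rewrite ler_piMl.
have h2 : `|y j| * `|e + D q| <= eta * (`|e| + `|D q|).
  by rewrite ler_pM// ler_normD.
have h3 : eta * `|e| <= `|e| by rewrite ler_piMl.
have h4 : eta * `|D q| <= (size q)%:R * eta ^+ 2.
  by rewrite expr2 mulrCA ler_wpM2l.
have h5 : (size q)%:R * eta ^+ 2 <= 4 ^+ size q * eta ^+ 2.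
  by rewrite ler_wpM2r// sqr_ge0.
have h6 := normr_ge0 e.
rewrite exprS -mulrA; move: h2; rewrite mulrDr => h2; lra.
Qed.

Section Curve.
Context {R : realType} {m : nat} {d : 'I_m -> nat}.

(** The scalar acts as one more perturbed factor, [1 + t * a / c], hence the exponent [m.+1]. *)
Lemma curve_remainder (c a t eta : R) (u w : forall j, 'I_(d j) -> R) v :
  c != 0 -> 0 <= eta <= 1 -> (forall j, dotv (u j) (u j) = 1) ->
  `|t * a| <= eta * `|c| -> (forall j i, `|t * w j i| <= eta) ->
  `|rank1 (c + t * a) (fun j i => u j i + t * w j i) v - rank1 c u v -
    t * (a * (\prod_j u j (v j)) +
         \sum_j c * (w j (v j) * \prod_(k | k != j) u k (v k)))| <=
  `|c| * 4 ^+ m.+1 * eta ^+ 2.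
Proof.
move=> c0 /andP[eta0 eta1] u1 ta tw.
have ule j i : `|u j i| <= 1.
  rewrite -(@ler_pXn2r _ 2)// ?nnegrE//.
  by rewrite real_normK ?num_real// expr1n -(u1 j) sqr_le_dotv.
pose x j := u j (v j); pose y j := t * w j (v j).
have := @prod_remainder _ _ (index_enum 'I_m) x y eta (index_enum_uniq _).
rewrite eta0 eta1 => /(_ isT (fun j => ule j _) (fun j => tw j _)).
set p := \prod_(i <- _) (x i + y i); set p0 := \prod_(i <- _) x i.
set D := \sum_(i <- _) _.
have -> : size (index_enum 'I_m) = m.
  by rewrite -[RHS]card_ord cardT enumT.
move=> He.
pose y0 := t * a / c.
have y0le : `|y0| <= eta by rewrite normrM normfV ler_pdivrMr ?normr_gt0.
have Hn : ((m%:R) : R) <= 4 ^+ m by rewrite -natrX ler_nat ltnW// ltn_expl.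
have p0le : `|p0| <= 1.
  by rewrite normr_prod; apply: prodr_ile1 => i _; rewrite normr_ge0 ule.
have Dle : `|D| <= m%:R * eta.
  apply: le_trans (ler_norm_sum _ _ _) _.
  apply: (@le_trans _ _ (\sum_(i < m) eta)); last by rewrite sumr_const card_ord mulr_natl.
  apply: ler_sum => i _; rewrite normrM -[leRHS]mulr1 ler_pM ?tw//.
  by rewrite normr_prod; apply: prodr_ile1 => k _; rewrite normr_ge0 ule.
rewrite !ffunE.
have -> : (c + t * a) * (\prod_j (u j (v j) + t * w j (v j))) - c * (\prod_j u j (v j)) -
    t * (a * (\prod_j u j (v j)) +
         \sum_j c * (w j (v j) * \prod_(k | k != j) u k (v k))) =
    c * ((p - p0 - D) + y0 * (p - p0 - D) + y0 * D).
  rewrite -/p -/p0 -mulr_sumr.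
  have -> : t * (a * p0 + c * \sum_j w j (v j) * \prod_(k | k != j) u k (v k)) =
      t * a * p0 + c * D.
    rewrite /D [in RHS](eq_bigr (fun j => t * (w j (v j) * \prod_(k | k != j) u k (v k)))).
      by rewrite -mulr_sumr; ring.
    by move=> j _; rewrite mulrA.
  by rewrite /y0; field.
rewrite normrM -mulrA ler_wpM2l//.
set e := p - p0 - D in He *.
apply: le_trans (ler_normD _ _) _; apply: le_trans (lerD (ler_normD _ _) (lexx _)) _.
rewrite (normrM y0 e) (normrM y0 D).
have h3 : `|y0| * `|e| <= `|e| by rewrite ler_piMl// (le_trans y0le).
have h4 : `|y0| * `|D| <= m%:R * eta ^+ 2.
  by rewrite expr2 mulrCA ler_pM.
have h5 : m%:R * eta ^+ 2 <= 4 ^+ m * eta ^+ 2.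
  by rewrite ler_wpM2r// sqr_ge0.
have h6 := normr_ge0 e.
rewrite exprS -[leRHS]mulrA; lra.
Qed.

(** Orthogonality of [u j] and [w j] makes every perturbed vector at least as long as a unit vector.
    Normalising therefore only shrinks entries and only enlarges the scalar. *)
Lemma curve_rank1 (c a t eta : R) (u w : forall j, 'I_(d j) -> R) :
  c != 0 -> 0 <= eta < 1 -> (forall j, dotv (u j) (u j) = 1) ->
  (forall j, dotv (u j) (w j) = 0) ->
  `|t * a| <= eta * `|c| -> (forall j i, `|t * w j i| <= eta) ->
  exists (c' : R) (x : forall j, 'I_(d j) -> R),
  [/\ rank1 (c + t * a) (fun j i => u j i + t * w j i) = rank1 c' x,
      forall j, dotv (x j) (x j) = 1,
      forall j i, `|x j i| <= `|u j i| + eta &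
      (1 - eta) * `|c| <= `|c'|].
Proof.
move=> c0 /andP[eta0 eta1] u1 uw ta tw.
pose y j i := u j i + t * w j i.
have yy j : 1 <= dotv (y j) (y j).
  have -> : dotv (y j) (y j) = dotv (u j) (u j) + 2 * t * dotv (u j) (w j)
     + t ^+ 2 * dotv (w j) (w j).
    rewrite /dotv !mulr_sumr -!big_split/=; apply: eq_bigr => i _.
    rewrite /y; ring.
  by rewrite u1 uw mulr0 addr0 lerDl mulr_ge0 ?sqr_ge0 ?dotv_ge0.
pose nu j := Num.sqrt (dotv (y j) (y j)).
have nu1 j : 1 <= nu j by rewrite -sqrtr1 ler_wsqrtr.
have nu0 j : 0 < nu j by exact: lt_le_trans (nu1 j).
exists ((c + t * a) * \prod_j nu j), (fun j i => y j i / nu j); split.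
- apply/ffunP => v; rewrite !ffunE -mulrA -big_split/=; congr (_ * _).
  by apply: eq_bigr => j _; rewrite [RHS]mulrC divfK// gt_eqF.
- move=> j; rewrite /dotv (eq_bigr (fun i => (nu j ^- 2) * (y j i * y j i))).
    rewrite -mulr_sumr -/(dotv (y j) (y j)) /nu sqr_sqrtr ?dotv_ge0//.
    by rewrite mulVf// gt_eqF// (lt_le_trans _ (yy j)).
  by move=> i _; field; rewrite gt_eqF.
- move=> j i; rewrite normrM normfV (gtr0_norm (nu0 j)) ler_pdivrMr//.
  apply: (@le_trans _ _ (`|u j i| + eta)).
    by apply: le_trans (ler_normD _ _) _; rewrite lerD2l.
  by rewrite ler_peMr// addr_ge0.
- rewrite normrM; apply: (@le_trans _ _ `|c + t * a|).
    have := lerB_normD c (t * a).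
    lra.
  rewrite ler_peMr// normr_prod.
  apply: (@le_trans _ _ (\prod_(j < m) 1)); first by rewrite big1.
  by apply: ler_prod => j _; rewrite ler01 gtr0_norm/=.
Qed.

End Curve.

(** * Quantitative bounds *)

(** From [1 - x <= expR (- x)] and [(1 + x + 2 x ^ 2) (1 - x) = 1 + x ^ 2 (1 - 2 x)]. *)
Lemma expR_le_quadratic {R : realType} (x : R) : 0 <= x <= 1 / 2 ->
  expR x <= 1 + x + 2 * x ^+ 2.
Proof.
move=> /andP[x0 x1].
have h : 1 - x <= expR (- x) by have := expR_ge1Dx (- x).
have x2 : 0 <= x ^+ 2 by exact: sqr_ge0.
have h2 : 1 <= (1 + x + 2 * x ^+ 2) * (1 - x) by nra.
have h3 : (1 + x + 2 * x ^+ 2) * (1 - x) <= (1 + x + 2 * x ^+ 2) * expR (- x).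
  by rewrite ler_wpM2l//; lra.
have := le_trans h2 h3.
by rewrite expRN ler_pdivlMr ?expR_gt0// mul1r.
Qed.

Lemma card_multi_index {R : realType} {m : nat} (d : 'I_m -> nat) :
  \sum_(w : multi_index d) (1 : R) = (dstar d)%:R.
Proof.
transitivity (\sum_(w : multi_index d) \prod_(j < m) (1 : R)).
  by apply: eq_bigr => w _; rewrite big1.
rewrite (sum_multi_index (fun j (i : 'I_(d j)) => 1)) /dstar natr_prod.
by apply: eq_bigr => j _; rewrite sumr_const card_ord.
Qed.

(** Each exponent is at most [S], so the exponentials are linear up to the factor [1 + 2 * S]. Their
    average is one plus a term of order [1 / dstar], its [n]-th power is at most
    [expR (q * (1 + 2 * S))], and the quadratic bound applies again. *)
Lemma chi2_le {R : realType} {m : nat} {d : 'I_m -> nat} (n : nat) (s : R)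
    (A B : tensor R d) (S q : R) :
  (0 < dstar d)%N -> s != 0 ->
  inner (B - A) (B - A) <= S * s ^+ 2 -> S <= 1 / 2 ->
  n%:R * S <= q * (dstar d)%:R -> q * (1 + 2 * S) <= 1 / 2 ->
  chi2 n s A B - 1 <= q * (1 + 2 * S) * (1 + 2 * (q * (1 + 2 * S))).
Proof.
move=> D0 s0 HS S1 nS q1.
have s2 : 0 < s ^+ 2 by rewrite exprn_even_gt0.
have DR : 0 < (dstar d)%:R :> R by rewrite ltr0n.
pose x (w : multi_index d) := (B w - A w) ^+ 2 / s ^+ 2.
have x0 w : 0 <= x w by rewrite divr_ge0 ?sqr_ge0.
have sumx : \sum_w x w <= S.
  rewrite -mulr_suml ler_pdivrMr//; apply: le_trans HS.
  by rewrite le_eqVlt; apply/orP; left; apply/eqP/eq_bigr => w _; rewrite !ffunE expr2.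
have S0 : 0 <= S by apply: le_trans sumx; exact: sumr_ge0.
have xS w : x w <= S.
  apply: le_trans sumx; rewrite (bigD1 w)//= lerDl; exact: sumr_ge0.
have ex w : expR (x w) <= 1 + x w * (1 + 2 * S).
  apply: le_trans (expR_le_quadratic _ _) _; first by rewrite x0 (le_trans (xS w)).
  have : x w * x w <= x w * S by rewrite ler_wpM2l.
  by rewrite expr2; lra.
have n0 : 0 <= n%:R :> R by [].
have q0 : 0 <= q.
  by rewrite -(pmulr_lge0 _ DR); apply: le_trans nS; rewrite mulr_ge0.
set z := q * (1 + 2 * S) in q1 *.
have z0 : 0 <= z by rewrite /z mulr_ge0//; lra.
have base : (dstar d)%:R^-1 * \sum_w expR (x w) <= 1 + (dstar d)%:R^-1 * (S * (1 + 2 * S)).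
  rewrite ler_pdivrMl//.
  apply: le_trans (ler_sum _ (fun w _ => ex w)) _.
  rewrite big_split/= card_multi_index -mulr_suml [leRHS]mulrDr mulr1 lerD2l mulrA divff ?gt_eqF//.
  by rewrite mul1r ler_wpM2r//; lra.
have chi : chi2 n s A B <= expR z.
  apply: (@le_trans _ _ (expR ((dstar d)%:R^-1 * (S * (1 + 2 * S))) ^+ n)).
    rewrite /chi2; apply: lerXn2r; rewrite ?nnegrE ?expR_ge0//.
      by rewrite mulr_ge0// sumr_ge0// => w _; exact: expR_ge0.
    by apply: le_trans base _; exact: expR_ge1Dx.
  rewrite -expRM_natl ler_expR mulrCA ler_pdivrMl// /z.
  rewrite mulrA [leRHS]mulrA [_ * q]mulrC ler_wpM2r//; lra.
have := expR_le_quadratic z; rewrite z0 q1 => /(_ isT).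
rewrite -/z expr2; lra.
Qed.

(* Here [z] is the inverse of the scale [M] of the problem, [z ^ 5] the step and
   [z ^ 30] the gap probability; the four corrections come from the curvature
   [e], the bias, the chi-square distance and the gap. *)
Lemma efficiency_numeric {R : realType}
    (z K om h lam L1 S e chi mse eps2 : R) :
  let tau := z ^+ 5 in let r := z ^+ 15 in let p := z ^+ 30 in
  0 < z -> 1 <= K -> 20 * K * z <= 1 -> 0 < om -> 0 < h -> 0 < lam ->
  0 <= L1 -> 1 <= S -> L1 * z <= S * h -> lam * z ^+ 2 <= om ->
  e <= K * tau ^+ 2 * om ->
  chi - 1 <= tau ^+ 2 * (1 + 8 * (K * z ^+ 4)) ->
  tau * om * h - e * L1 - lam * L1 * p <=
    tau / (om * h) / 2 * mse +
    (chi - 1 + 2 * p + r * (chi + 1)) / (2 * (tau / (om * h))) ->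
  S * z ^+ 3 <= eps2 -> (1 - eps2) * (om ^+ 2 * h ^+ 2) <= mse.
Proof.
move=> tau r p z0 K1 Kz om0 h0 lam0 L10 S1 L1z lamz eK chiK main epsS.
pose V := om ^+ 2 * h ^+ 2.
have V0 : 0 < V by rewrite mulr_gt0// exprn_gt0.
have tau0 : 0 < tau by rewrite exprn_gt0.
have z1 : z <= 1 / 20 by nra.
(* Multiplication by [2 / theta]. The linear gain is [2 * V] and the leading chi-square term takes
   back one [V], leaving the efficiency bound. *)
have main2 : 2 * V - 2 * (om * h / tau) * (e * L1) -
    2 * (om * h / tau) * (lam * L1 * p) - V / tau ^+ 2 * (chi - 1) -
    V / tau ^+ 2 * (2 * p + r * (chi + 1)) <= mse.
  have c0 : 0 < 2 * (om * h) / tau by rewrite divr_gt0// mulr_gt0// mulr_gt0.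
  have := ler_wpM2l (ltW c0) main.
  have -> : 2 * (om * h) / tau * (tau * om * h - e * L1 - lam * L1 * p) =
     2 * V - 2 * (om * h / tau) * (e * L1) - 2 * (om * h / tau) * (lam * L1 * p).
    by rewrite /V; field; rewrite gt_eqF.
  have -> : 2 * (om * h) / tau * (tau / (om * h) / 2 * mse +
    (chi - 1 + 2 * p + r * (chi + 1)) / (2 * (tau / (om * h)))) =
    mse + V / tau ^+ 2 * (chi - 1) + V / tau ^+ 2 * (2 * p + r * (chi + 1)).
    by rewrite /V; field; rewrite !gt_eqF.
  lra.
have c0 : 0 <= om * h / tau.
  by apply: divr_ge0; [apply: mulr_ge0; exact: ltW|exact: ltW].
have b1 : om * h / tau * (e * L1) <= V * (K * S * z ^+ 4).
  have -> : V * (K * S * z ^+ 4) =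
      om * h / tau * ((K * tau ^+ 2 * om) * (S * h / z)).
    by rewrite /V /tau; field; rewrite gt_eqF.
  apply: ler_wpM2l => //.
  apply: (@le_trans _ _ (K * tau ^+ 2 * om * L1)); first by rewrite ler_wpM2r.
  apply: ler_wpM2l; last by rewrite ler_pdivlMr.
  by apply: mulr_ge0; [apply: mulr_ge0; [lra|exact: sqr_ge0]|exact: ltW].
(* The exponent is [30 - 5 - 2 - 1], from [p], [tau], [lam / om] and [L1 / (S * h)]. *)
have b2 : om * h / tau * (lam * L1 * p) <= V * (S * z ^+ 22).
  have -> : V * (S * z ^+ 22) =
      om * h / tau * ((om / z ^+ 2) * (S * h / z) * p).
    by rewrite /V /tau /p; field; rewrite gt_eqF.
  apply: ler_wpM2l => //; apply: ler_wpM2r; first by rewrite exprn_ge0// ltW.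
  apply: ler_pM => //; first exact: ltW.
    by rewrite ler_pdivlMr// exprn_gt0.
  by rewrite ler_pdivlMr.
have b3 : V / tau ^+ 2 * (chi - 1) <= V * (1 + 8 * (K * z ^+ 4)).
  rewrite -mulrA; apply: ler_wpM2l; first exact: ltW.
  by rewrite mulrC ler_pdivrMr ?exprn_gt0// mulrC.
have z4 : K * z ^+ 4 <= z ^+ 3 / 20.
  have -> : K * z ^+ 4 = (20 * K * z) * (z ^+ 3 / 20) by field.
  by rewrite ler_piMl// divr_ge0// exprn_ge0// ltW.
have zle (i j : nat) : (i <= j)%N -> z ^+ j <= z ^+ i.
  by move=> ij; apply: ler_wiXn2l => //; [exact: ltW|lra].
have chi2 : chi <= 3.
  have h1 : tau ^+ 2 <= 1 by rewrite /tau -exprM; apply: exprn_ile1; [exact: ltW|lra].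
  have h2 : K * z ^+ 4 <= 1 / 8 by have := zle 0%N 3%N isT; rewrite expr0; lra.
  have : tau ^+ 2 * (1 + 8 * (K * z ^+ 4)) <= 1 * 2.
    have zK : 0 <= K * z ^+ 4 by apply: mulr_ge0; [lra|rewrite exprn_ge0// ltW].
    by rewrite ler_pM ?sqr_ge0//; lra.
  lra.
have b4 : V / tau ^+ 2 * (2 * p + r * (chi + 1)) <= V * (6 * z ^+ 5).
  have -> : V * (6 * z ^+ 5) = V / tau ^+ 2 * (6 * r).
    by rewrite /tau /r; field; rewrite gt_eqF.
  apply: ler_wpM2l; first by apply: divr_ge0; [exact: ltW|exact: sqr_ge0].
  have pr : p <= r by exact: zle.
  have r0 : 0 < r by rewrite exprn_gt0.
  have : r * (chi + 1) <= r * 4 by apply: ler_wpM2l; [exact: ltW|lra].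
  lra.
have z3 : 0 < z ^+ 3 by rewrite exprn_gt0.
have z5 : z ^+ 5 <= z ^+ 3 / 400.
  have -> : z ^+ 5 = z ^+ 2 * z ^+ 3 by ring.
  have : z ^+ 2 <= 1 / 400 by rewrite expr2; nra.
  move=> H; have := ler_wpM2r (ltW z3) H; lra.
have z22 : z ^+ 22 <= z ^+ 5 by exact: zle.
(* The four terms are at most 1/10, 1/200, 2/5 and 3/200 of [S * z ^ 3]; the 20 in [20 * K * z <= 1]
   is chosen for this. *)
have fin : 2 * (K * S * z ^+ 4) + 2 * (S * z ^+ 22) + 8 * (K * z ^+ 4) +
    6 * z ^+ 5 <= eps2.
  apply: le_trans epsS.
  have S0 : 0 <= S by lra.
  have := ler_wpM2l S0 z4; have := ler_wpM2l S0 z22; have := ler_wpM2l S0 z5.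
  have := ler_wpM2r (ltW z3) S1.
  have -> : S * (K * z ^+ 4) = K * S * z ^+ 4 by ring.
  lra.
have := ler_wpM2l (ltW V0) fin; rewrite -/V; lra.
Qed.

(** Times [ln dbar], [mtilde] is the logarithm of the largest of [dbar ^ m], [n] and [l / s], so the
    gap probability is a negative power of that maximum. *)
Lemma mtilde_gap {R : realType} {m : nat} {d : 'I_m -> nat} (n : nat)
    (s l Y : R) (A : tensor R d) (k : nat) :
  (1 < dbar d)%N -> lambda_max A = l -> 0 < Y -> 
  [|| Y <= (dbar d)%:R ^+ m, Y <= n%:R | Y <= l / s] ->
  (dbar d)%:R `^ (- (k%:R * mtilde n s A)) <= (Y ^+ k)^-1.
Proof.
move=> b1 lA Y0 HY.
have b0 : 0 < (dbar d)%:R :> R by rewrite ltr0n ltnW.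
have lnb : 0 < ln (dbar d)%:R :> R by rewrite ln_gt0// ltr1n.
have key : ln Y <= mtilde n s A * ln (dbar d)%:R.
  rewrite /mtilde lA maxr_pMl; last exact: ltW.
  rewrite le_max divfK ?gt_eqF//.
  have mono (y : R) : Y <= y -> ln Y <= ln y.
    by move=> Yy; rewrite ler_ln// posrE (lt_le_trans Y0).
  case/or3P: HY => HY.
  - by apply/orP; left; rewrite mulr_natl -lnXn// mono.
  - by apply/orP; right; apply: mono; rewrite le_max HY.
  - by apply/orP; right; apply: mono; rewrite le_max HY orbT.
rewrite /powR gt_eqF// -[in leRHS](lnK (x := Y)) ?posrE//.
rewrite -expRM_natl -expRN ler_expR mulNr lerN2 -mulrA ler_wpM2l//.
Qed.

Lemma entry_le_frob {R : realType} {m : nat} {d : 'I_m -> nat}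
    (A : tensor R d) v : `|A v| <= frob A.
Proof.
rewrite -(@ler_pXn2r _ 2)// ?nnegrE ?frob_ge0// sqr_frob real_normK ?num_real//.
rewrite /inner (bigD1 v)//= expr2 lerDl.
by apply: sumr_ge0 => w _; rewrite -expr2 sqr_ge0.
Qed.

Lemma inner_linearization {R : realType} {m : nat} {d : 'I_m -> nat}
    (F H I : tensor R d) (t e : R) :
  (forall v, `|F v - t * H v| <= e) ->
  t * inner H I - e * l1norm I <= inner F I.
Proof.
move=> Fe; pose r : tensor R d := [ffun v => F v - t * H v].
have : `|inner r I| <= e * l1norm I.
  by apply: inner_le_l1norm => v; rewrite ffunE.
have -> : inner r I = inner F I - t * inner H I.
  rewrite /inner mulr_sumr -sumrB; apply: eq_bigr => v _.
  by rewrite ffunE mulrBl mulrA.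
by rewrite ler_norml => /andP[]; lra.
Qed.

(** The entrywise error is summed crudely over all [dstar] entries; the loss is affordable because
    [dstar <= M]. *)
Lemma sqr_linearization {R : realType} {m : nat} {d : 'I_m -> nat}
    (F H : tensor R d) (t e : R) :
  0 <= t -> (forall v, `|F v - t * H v| <= e) ->
  inner F F <= t ^+ 2 * frob H ^+ 2 + (dstar d)%:R * (2 * t * frob H * e + e ^+ 2).
Proof.
move=> t0 Fe; rewrite sqr_frob -card_multi_index mulr_sumr mulr_suml -big_split/=.
apply: ler_sum => v _; rewrite mul1r.
have He := Fe v; have Hv := entry_le_frob H v.
set r := F v - t * H v in He.
have -> : F v * F v = t ^+ 2 * (H v * H v) + (2 * t * (H v * r) + r ^+ 2).
  by rewrite /r; ring.
rewrite lerD2l; apply: lerD.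
  rewrite -!mulrA; do 2 (apply: ler_wpM2l => //).
  by apply: le_trans (ler_norm _) _; rewrite normrM ler_pM.
by rewrite -(real_normK (num_real r)) lerXn2r ?nnegrE// (le_trans _ He).
Qed.

(** With [kap = K * z ^ 4], both correction factors of [chi2_le] are at most [1 + kap], since [S] is
    of order [z ^ 9]. The 8 bounds the expansion of [(1 + 3 kap) (1 + kap) ^ 2] for
    [kap <= 1 / 20]. *)
Lemma chi2_numeric {R : realType} (z K S q : R) :
  0 < z -> 1 <= K -> 20 * K * z <= 1 ->
  q = (z ^+ 5) ^+ 2 * (1 + 3 * (K * z ^+ 4)) -> 0 <= S -> S <= q / z ->
  [/\ S <= 1 / 2, q * (1 + 2 * S) <= 1 / 2 &
  q * (1 + 2 * S) * (1 + 2 * (q * (1 + 2 * S))) <=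
    (z ^+ 5) ^+ 2 * (1 + 8 * (K * z ^+ 4))].
Proof.
move=> z0 K1 Kz qE S0 Sq.
have z1 : z <= 1 / 20 by nra.
have zp k : 0 < z ^+ k by rewrite exprn_gt0.
have zle (i j : nat) : (i <= j)%N -> z ^+ j <= z ^+ i.
  by move=> ij; apply: ler_wiXn2l => //; [exact: ltW|lra].
set kap := K * z ^+ 4 in qE *.
have kap0 : z ^+ 4 <= kap by rewrite /kap ler_peMl// ltW.
have kap1 : kap <= 1 / 20.
  have -> : kap = (20 * K * z) * (z ^+ 3 / 20) by rewrite /kap; field.
  have := zle 0%N 3%N isT; rewrite expr0 => z3.
  apply: (@le_trans _ _ (z ^+ 3 / 20)); last lra.
  by apply: ler_piMl => //; rewrite divr_ge0// ltW.
have tau2 : (z ^+ 5) ^+ 2 = z ^+ 10 by rewrite -exprM.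
rewrite tau2 in qE *.
have z10 := zp 10%N.
have q2 : q <= 2 * z ^+ 10 by rewrite qE mulrC; apply: ler_wpM2r; [exact: ltW|lra].
have z45 : 2 * z ^+ 5 <= 1 / 200.
  have := zle 2%N 5%N isT; have : z ^+ 2 <= 1 / 400 by rewrite expr2; nra.
  lra.
have z9 : z ^+ 9 = z ^+ 5 * z ^+ 4 by ring.
have z9' : z ^+ 9 <= 1 / 400 * z ^+ 4.
  by rewrite z9; apply: ler_wpM2r; [exact: ltW|lra].
have z109 : z ^+ 10 <= z ^+ 9 by exact: zle.
have S9 : S <= 2 * z ^+ 9.
  apply: le_trans Sq _; rewrite ler_pdivrMr//.
  by have -> : 2 * z ^+ 9 * z = 2 * z ^+ 10 by ring.
have z4 := zp 4%N.
have S2 : 2 * S <= kap by lra.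
have q0 : 0 <= q by rewrite qE; apply: mulr_ge0; [exact: ltW|lra].
have y1 : q * (1 + 2 * S) <= q * 2 by rewrite ler_wpM2l//; lra.
have y2 : 2 * (q * (1 + 2 * S)) <= kap by lra.
split; [lra|lra|].
have y0 : 0 <= q * (1 + 2 * S) by rewrite mulr_ge0//; lra.
apply: (@le_trans _ _ (z ^+ 10 * (1 + 3 * kap) * (1 + kap) * (1 + kap))).
  rewrite ler_pM//; [lra| |lra].
  by rewrite -qE ler_wpM2l//; lra.
have k0 : 0 <= kap by lra.
have k2 : kap ^+ 2 <= kap / 20 by rewrite expr2; nra.
have k3 : kap ^+ 3 <= kap / 20.
  have -> : kap ^+ 3 = kap ^+ 2 * kap by ring.
  by apply: le_trans k2; rewrite ler_piMr ?sqr_ge0//; lra.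
have -> : z ^+ 10 * (1 + 3 * kap) * (1 + kap) * (1 + kap) =
  z ^+ 10 * (1 + 5 * kap + 7 * kap ^+ 2 + 3 * kap ^+ 3) by ring.
apply: ler_wpM2l; [exact: ltW|lra].
Qed.

Lemma measurable_Bopt {R : realType} {m : nat} {d : 'I_m -> nat} {n : nat}
    (phi : estimator R d n) (C0 s : R) (A : tensor R d) :
  measurable_estimator phi ->
  sample_measurable (fun x y => \1_(Bopt C0 n s A) (phi x y) : R).
Proof.
move=> mphi x.
pose c := C0 * (s ^+ 2 * (dstar d)%:R * (dbar d)%:R * ln (dbar d)%:R / n%:R).
pose f (y : n.-tuple R) : R := \sum_v (phi x y v - A v) ^+ 2.
have mf : measurable_fun setT f.
  apply: measurable_sum => v; apply: measurable_funX; apply: measurable_funB.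
    exact: mphi.
  exact: measurable_cst.
have -> : (fun y => \1_(Bopt C0 n s A) (phi x y) : R) = \1_(f @^-1` `]-oo, c]).
  apply/funext => y; rewrite !indicE.
  suff -> : (phi x y \in Bopt C0 n s A) = (y \in f @^-1` `]-oo, c]) by [].
  have fE : frob (phi x y - A) ^+ 2 = f y.
    by rewrite sqr_frob; apply: eq_bigr => v _; rewrite !ffunE expr2.
  apply/idP/idP; rewrite !inE /= in_itv/=.
    by rewrite /Bopt/= fE.
  by rewrite /Bopt/= fE.
apply: measurable_indic; rewrite -[X in measurable X]setTI.
by apply: mf => //; exact: measurable_itv.
Qed.

(** The quadratic bound at 1/2 reads [expR (1 / 2) <= 2]. *)
Lemma ln2_ge_half {R : realType} : 1 / 2 <= ln (2 : R).
Proof.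
rewrite -[leLHS]expRK ler_ln ?posrE ?expR_gt0//.
have := @expR_le_quadratic R (1 / 2); rewrite lexx andbT => /(_ _) H.
have := H ltac:(lra); rewrite expr2; lra.
Qed.

(** * Elementary consequences of the model *)

Section FiniteSample.
Context {R : realType} {m : nat} {d : 'I_m -> nat}.
Variables (T : tensor R d) (core : tensor R (@rank_one m))
  (U : forall j, 'M[R]_(d j, rank_one j)).
Hypotheses (b1 : (1 < dbar d)%N) (model : tucker_model T core U).

Local Notation c := (core core_index).

Lemma mode_exists : {j : 'I_m | True}.
Proof.
case: m d b1 => [d0|m' d0 _]; last by exists ord0.
by rewrite /dbar big_ord0.
Qed.

Lemma modelE : T = rank1 c (colv U).
Proof. by case: model => _ -> _; rewrite tucker_rank1. Qed.

Lemma model_unit j : dotv (colv U j) (colv U j) = 1.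
Proof. by case: model => U1 _ _; exact: colv_unit. Qed.

Lemma core_neq0 : c != 0.
Proof.
have [j _] := mode_exists; case: model => _ _ /(_ j) rk.
apply/negP => /eqP c0; move: rk; rewrite modelE.
suff -> : unfold j (rank1 c (colv U)) = 0 by rewrite mxrank0.
by apply/matrixP => i a; rewrite unfold_rank1 c0 !mul0r mxE.
Qed.

Lemma dim_gt0 j : (0 < d j)%N.
Proof.
rewrite lt0n; apply/eqP => dj; have := model_unit j.
rewrite /dotv big1 => [/eqP|i _]; first by rewrite eq_sym oner_eq0.
by have := ltn_ord i; rewrite {2}dj.
Qed.

Lemma dstar_gt0 : (0 < dstar d)%N.
Proof. by apply: prodn_gt0 => j; exact: dim_gt0. Qed.

Lemma dim_le_dbar j : (d j <= dbar d)%N.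
Proof. exact: leq_bigmax. Qed.

Lemma dstar_le : (dstar d <= dbar d ^ m)%N.
Proof.
rewrite -[X in (_ <= _ ^ X)%N]card_ord -prod_nat_const.
by apply: leq_prod => j _; exact: dim_le_dbar.
Qed.

Lemma dbar_le_exp : (dbar d <= dbar d ^ m)%N.
Proof.
have [j _] := mode_exists.
by rewrite -{1}[dbar d]expn1 leq_exp2l// (leq_ltn_trans _ (ltn_ord j)).
Qed.

Lemma entry_le_core v : `|T v| <= `|c|.
Proof.
rewrite modelE ffunE normrM ler_piMr// normr_prod.
apply: prodr_ile1 => j _; rewrite normr_ge0/=.
rewrite -(@ler_pXn2r _ 2)// ?nnegrE//.
by rewrite real_normK ?num_real// expr1n -(model_unit j) sqr_le_dotv.
Qed.

Lemma colv_incoherent mu j i : incoherent mu U ->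
  `|colv U j i| <= Num.sqrt (mu / (d j)%:R).
Proof.
by move=> /(_ j); rewrite mulr1; apply: le_trans; exact: two_inf_colv.
Qed.

(** A unit vector has [d j] squared entries, each at most [mu / d j]. This allows the power of [mu]
    in [eps_snr] to be dropped. *)
Lemma incoherence_ge1 mu : 0 < mu -> incoherent mu U -> 1 <= mu.
Proof.
move=> mu0 inc; have [j _] := mode_exists.
have dj : 0 < (d j)%:R :> R by rewrite ltr0n dim_gt0.
rewrite -(model_unit j) /dotv.
apply: (@le_trans _ _ (\sum_(i < d j) mu / (d j)%:R)).
  apply: ler_sum => i _; rewrite -expr2 -(real_normK (num_real _)).
  rewrite -[leRHS]sqr_sqrtr; last by rewrite divr_ge0// ltW.
  by rewrite lerXn2r ?nnegrE ?sqrtr_ge0//; exact: colv_incoherent.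
by rewrite sumr_const card_ord -[X in X <= _]mulr_natr divfK// gt_eqF.
Qed.

End FiniteSample.

(** * The scale of the problem *)

Section Scale.
Context {R : realType} {m : nat} {d : 'I_m -> nat}.

(* All quantities of the problem are at most a power of this one, and the gap
   probability is at most an arbitrary inverse power of it. *)
Definition scale (n : nat) (l s : R) : R :=
  Num.max ((dbar d)%:R ^+ m) (Num.max n%:R (l / s)).

(* Half of the exponent is given up because a perturbed tensor may only have
   scale [M / 2]: [(M / 2) ^ 2 >= M] as soon as [M >= 4]. *)
Lemma mtilde_gap_scale (n : nat) (s l l' : R) (A : tensor R d) :
  (1 < dbar d)%N -> 0 < s -> 4 <= scale n l s -> l / 2 <= l' ->
  lambda_max A = l' ->
  (dbar d)%:R `^ (- (60 * mtilde n s A)) <= (scale n l s)^-1 ^+ 30.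
Proof.
move=> b1 s0 M4 ll lA.
have : [|| scale n l s <= (dbar d)%:R ^+ m, scale n l s <= n%:R | scale n l s <= l / s].
  by rewrite -!le_max.
move: (scale n l s) M4 => M M4 HM.
have H : [|| M / 2 <= (dbar d)%:R ^+ m, M / 2 <= n%:R | M / 2 <= l' / s].
  case/or3P: HM => Hm; apply/or3P.
  - by apply: Or31; lra.
  - by apply: Or32; lra.
  - apply: Or33; rewrite ler_pdivlMr//.
    by move: Hm; rewrite ler_pdivlMr//; lra.
apply: le_trans (mtilde_gap n s l' (M / 2) A 60 b1 lA _ H) _; first lra.
rewrite exprVn lef_pV2 ?posrE ?exprn_gt0//; [|lra|lra].
rewrite (exprM _ 2 30) lerXn2r ?nnegrE ?sqr_ge0//; first lra.
have := ler_wpM2l (_ : 0 <= M) M4 => /(_ ltac:(lra)); rewrite expr2; lra.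
Qed.

End Scale.

(** * Signal, noise level and linear form measured in the scale *)

Section Efficiency.
Context {R : realType} {m : nat} {d : 'I_m -> nat}.
Variables (mu alpha s : R) (n : nat) (T I : tensor R d)
  (core : tensor R (@rank_one m)) (U : forall j, 'M[R]_(d j, rank_one j)).
Hypotheses (mu0 : 0 < mu) (b1 : (1 < dbar d)%N) (n0 : (0 < n)%N) (s0 : 0 < s)
  (alpha0 : 0 < alpha) (model : tucker_model T core U)
  (inc : incoherent mu U)
  (alignment : alpha * Num.sqrt (dbar d)%:R / Num.sqrt (dstar d)%:R * frob I
     <= frob (proj_tangent core U I)).

Local Notation c := (core core_index).
Local Notation D := ((dstar d)%:R : R).
Local Notation b := ((dbar d)%:R : R).
Local Notation M := (@scale R m d n `|c| s).
Local Notation S := (Num.max (l1norm I / (alpha * frob I)) 1).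
Local Notation omega := (Num.sqrt (s ^+ 2 * D / n%:R)).
Local Notation eps := (eps_snr 1 mu alpha n s T I).
Local Notation h := (frob (proj_tangent core U I)).

Lemma dstar_ge1 : 1 <= D. Proof. by rewrite ler1n; apply: (dstar_gt0 T core U). Qed.
Lemma dbar_ge2 : 2 <= b. Proof. by rewrite (ler_nat _ 2). Qed.
Lemma size_ge1 : 1 <= n%:R :> R. Proof. by rewrite ler1n. Qed.
Lemma core_gt0 : 0 < `|c|. Proof. by rewrite normr_gt0; exact: (core_neq0 T core U). Qed.

Lemma scale_ge :
  [/\ D <= M, n%:R <= M, `|c| <= M * s, b <= M & 2 <= M].
Proof.
have b2 := dbar_ge2.
have bM : b ^+ m <= M by rewrite le_max lexx.
have bb : b <= b ^+ m by rewrite -natrX ler_nat; exact: (dbar_le_exp b1).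
split.
- by apply: le_trans bM; rewrite -natrX ler_nat; exact: dstar_le.
- by rewrite !le_max lexx orbT.
- by rewrite -ler_pdivrMr// !le_max lexx !orbT.
- exact: le_trans bM.
- by apply: le_trans bM; exact: le_trans bb.
Qed.

Lemma dbar_ln_ge1 : 1 <= b * ln b.
Proof.
have b2 := dbar_ge2.
have l2 : 1 / 2 <= ln b.
  by apply: le_trans ln2_ge_half _; rewrite ler_ln ?posrE//; lra.
have := ler_pM _ _ b2 l2; lra.
Qed.

Lemma sqr_omega : omega ^+ 2 = s ^+ 2 * D / n%:R.
Proof.
have D1 := dstar_ge1. have n1 := size_ge1.
rewrite sqr_sqrtr//; apply: divr_ge0; last by lra.
by apply: mulr_ge0; [exact: sqr_ge0|lra].
Qed.

Lemma omega_gt0 : 0 < omega.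
Proof.
have D1 := dstar_ge1. have n1 := size_ge1.
rewrite sqrtr_gt0; apply: divr_gt0; last lra.
by apply: mulr_gt0; [exact: exprn_gt0|lra].
Qed.

Lemma eps_ge0 : 0 <= eps.
Proof.
rewrite /eps_snr mul1r mulr_ge0 ?sqrtr_ge0// divr_ge0 ?(ltW s0)//.
have [j0 _] := mode_exists b1.
rewrite (modelE T core U model) lambda_min_rank1 ?normr_ge0//.
  exact: (core_neq0 T core U).
exact: (model_unit T core U model).
Qed.

Lemma sqr_eps_ge : S * (omega ^+ 2 / c ^+ 2) <= eps ^+ 2.
Proof.
have D1 := dstar_ge1. have n1 := size_ge1. have c0 := core_gt0.
have [j0 _] := mode_exists b1.
have S0 : 0 <= S by rewrite le_max ler01 orbT.
have mu1 : 1 <= mu by exact: (incoherence_ge1 T core U b1 model).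
have mupow : 1 <= mu `^ (3 * m%:R / 2).
  have := @ler_powR R mu mu1 0 (3 * m%:R / 2); rewrite powRr0; apply.
  by rewrite divr_ge0// mulr_ge0.
have H : 1 <= mu `^ (3 * m%:R / 2) * (b * ln b).
  have := ler_pM ler01 ler01 mupow dbar_ln_ge1; rewrite mulr1; exact.
rewrite /eps_snr mul1r exprMn.
rewrite (modelE T core U model) lambda_min_rank1//; last 2 first.
- by rewrite -normr_gt0.
- exact: (model_unit T core U model).
rewrite sqr_omega sqr_sqrtr; last first.
  apply: mulr_ge0; first exact: S0.
  apply: divr_ge0; last by lra.
  have -> : mu `^ (3 * m%:R / 2) * b * D * ln b = mu `^ (3 * m%:R / 2) * (b * ln b) * D by ring.
  by apply: mulr_ge0; lra.
rewrite exprMn exprVn real_normK ?num_real//.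
have -> : s ^+ 2 / c ^+ 2 * (S * (mu `^ (3 * m%:R / 2) * b * D * ln b / n%:R)) =
  S * (s ^+ 2 * D / n%:R / c ^+ 2) * (mu `^ (3 * m%:R / 2) * (b * ln b)).
  ring.
apply: ler_peMr => //; apply: mulr_ge0 => //.
by rewrite -sqr_omega divr_ge0 ?sqr_ge0.
Qed.

(** Two powers of [M] pay for the squared signal-to-noise ratio and one for [n]. Read backwards, a
    small [eps] forces a large [M]. *)
Lemma sqr_eps_scale : S * M^-1 ^+ 3 <= eps ^+ 2.
Proof.
have c0 := core_gt0.
have D1 := dstar_ge1. have n1 := size_ge1.
apply: le_trans sqr_eps_ge; have [DM nM cM bM M2] := scale_ge.
apply: ler_wpM2l; first by rewrite le_max ler01 orbT.
have c2 : 0 < c ^+ 2 by rewrite -(real_normK (num_real _)) exprn_gt0.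
rewrite sqr_omega ler_pdivlMr//.
have M0 : 0 < M by lra.
have nn : 0 < n%:R :> R by lra.
rewrite ler_pdivlMr//.
have cc : c ^+ 2 <= (M * s) ^+ 2.
  by rewrite -(real_normK (num_real c)) lerXn2r ?nnegrE// mulr_ge0 ?ltW.
apply: (@le_trans _ _ (M^-1 ^+ 3 * (M * s) ^+ 2 * M)).
  apply: ler_pM => //; first by rewrite mulr_ge0 ?sqr_ge0// exprn_ge0// invr_ge0 ltW.
  by apply: ler_wpM2l => //; rewrite exprn_ge0// invr_ge0 ltW.
have -> : M^-1 ^+ 3 * (M * s) ^+ 2 * M = s ^+ 2 by field; rewrite gt_eqF.
by rewrite ler_peMr// sqr_ge0.
Qed.

Lemma omega_le : eps <= 1 -> omega <= `|c|.
Proof.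
have c0 := core_gt0.
move=> e1; rewrite -(@ler_pXn2r _ 2)// ?nnegrE ?sqrtr_ge0//.
rewrite real_normK ?num_real//.
have c2 : 0 < c ^+ 2 by rewrite -(real_normK (num_real _)) exprn_gt0.
have S1 : 1 <= S by rewrite le_max lexx orbT.
have eps1 : eps ^+ 2 <= 1 by rewrite exprn_ile1// eps_ge0.
have w0 : 0 <= omega ^+ 2 / c ^+ 2 by rewrite divr_ge0 ?sqr_ge0.
have : 1 * (omega ^+ 2 / c ^+ 2) <= 1.
  by apply: le_trans eps1; apply: le_trans sqr_eps_ge; apply: ler_wpM2r.
by rewrite mul1r ler_pdivrMr// mul1r.
Qed.

Lemma core_le_omega : `|c| * M^-1 ^+ 2 <= omega.
Proof.
have n1 := size_ge1.
have D1 := dstar_ge1.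
have [DM nM cM bM M2] := scale_ge.
have M0 : 0 < M by lra.
have nn : 0 < n%:R :> R by lra.
rewrite exprVn ler_pdivrMr ?exprn_gt0//.
have -> : omega * M ^+ 2 = M * (omega * M) by ring.
apply: le_trans cM _; apply: ler_wpM2l; first exact: ltW.
rewrite -(@ler_pXn2r _ 2)// ?nnegrE; [|exact: ltW|by rewrite mulr_ge0 ?sqrtr_ge0// ltW].
rewrite exprMn sqr_omega mulrAC ler_pdivlMr//.
rewrite -[leRHS]mulrA ler_wpM2l ?sqr_ge0//.
apply: le_trans nM _; rewrite -[leLHS]mul1r expr2 mulrA ler_wpM2r//; first exact: ltW.
by rewrite -[leLHS]mul1r ler_pM//; lra.
Qed.

(** The alignment hypothesis enters here: [S] compares the l1 norm with [alpha * frob I], and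
    alignment compares that with [h] up to a factor at most [dstar <= M]. *)
Lemma l1norm_le : 0 < h -> l1norm I * M^-1 <= S * h.
Proof.
have D1 := dstar_ge1. have b2 := dbar_ge2.
move=> h0; have [DM nM cM bM M2] := scale_ge.
have M0 : 0 < M by lra.
(* For [frob I = 0] the quotient in [S] is a division by zero; that case is excluded by
   [inner I H = inner H H]. *)
have I0 : 0 < frob I.
  rewrite lt_neqAle frob_ge0 andbT eq_sym; apply/negP => /eqP I0.
  have [a [w [_ _ IH _]]] := tangent_decomp core U I (fun j => let: And3 U1 _ _ := model in U1 j).
  move: IH; rewrite -sqr_frob.
  have Iv v : I v = 0.
    by apply/eqP; rewrite -normr_le0 -I0; exact: entry_le_frob.
  rewrite {1}/inner big1 => [/esym/eqP|v _]; last by rewrite Iv mul0r.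
  by rewrite sqrf_eq0 gt_eqF.
have aI : 0 < alpha * frob I by rewrite mulr_gt0.
have L1 : l1norm I <= S * (alpha * frob I).
  by rewrite -ler_pdivrMr// le_max lexx.
have aIh : alpha * frob I <= h * D.
  have sD : 0 < Num.sqrt D by rewrite sqrtr_gt0; lra.
  have : alpha * Num.sqrt b * frob I <= h * Num.sqrt D.
    by rewrite -ler_pdivrMr//; apply: le_trans alignment; rewrite mulrAC.
  have sb : 1 <= Num.sqrt b by rewrite -[leLHS]sqrtr1; apply: ler_wsqrtr; lra.
  have sDD : Num.sqrt D <= D.
    rewrite -[leRHS]sqr_sqrtr; last lra.
    by rewrite expr2 ler_peMl ?sqrtr_ge0// -[leLHS]sqrtr1; apply: ler_wsqrtr.
  move=> H; apply: (@le_trans _ _ (alpha * Num.sqrt b * frob I)).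
    by rewrite mulrAC ler_peMr// ltW.
  by apply: le_trans H _; rewrite ler_wpM2l// ltW.
rewrite ler_pdivrMr//; apply: le_trans L1 _.
rewrite -mulrA; apply: ler_wpM2l; first by rewrite le_max ler01 orbT.
by apply: le_trans aIh _; rewrite ler_wpM2l// ltW.
Qed.

End Efficiency.

(** * The finite-sample bound *)

Lemma tensor_subE {R : realType} {m : nat} {d : 'I_m -> nat}
    (A B : tensor R d) v : (A - B) v = A v - B v.
Proof. by rewrite !ffunE. Qed.

(** One factor [z] cancels [D]; the 3 is [2 + K * z ^ 5] rounded up, from the cross term and the
    squared remainder. *)
Lemma deviation_numeric {R : realType} (z K om D e E : R) :
  0 < z -> 1 <= K -> 20 * K * z <= 1 -> 0 <= om -> 0 <= D -> D * z <= 1 ->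
  0 <= e -> e <= K * (z ^+ 5) ^+ 2 * om ->
  E <= (z ^+ 5 * om) ^+ 2 + D * (2 * (z ^+ 5 * om) * e + e ^+ 2) ->
  E <= (z ^+ 5) ^+ 2 * (1 + 3 * (K * z ^+ 4)) * om ^+ 2.
Proof.
move=> z0 K1 Kz om0 D0 Dz e0 eK HE.
have z1 : z <= 1 by nra.
have zk k : 0 <= z ^+ k by rewrite exprn_ge0// ltW.
set E0 := K * (z ^+ 5) ^+ 2 * om in eK.
have K0 : 0 <= K by exact: le_trans K1.
have E00 : 0 <= E0 by apply: mulr_ge0 => //; apply: mulr_ge0 => //; exact: sqr_ge0.
have h1 : 2 * (z ^+ 5 * om) * e + e ^+ 2 <= 2 * (z ^+ 5 * om) * E0 + E0 ^+ 2.
  apply: lerD; last by rewrite lerXn2r ?nnegrE.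
  by apply: ler_wpM2l => //; apply: mulr_ge0 => //; apply: mulr_ge0.
have h2 : D * (2 * (z ^+ 5 * om) * e + e ^+ 2) <=
    D * (2 * (z ^+ 5 * om) * E0 + E0 ^+ 2) by apply: ler_wpM2l.
have W0 : 0 <= (z ^+ 5) ^+ 2 * om ^+ 2 * (K * z ^+ 4).
  by apply: mulr_ge0; [apply: mulr_ge0; exact: sqr_ge0|exact: mulr_ge0].
have Kz5 : K * z ^+ 5 <= 1.
  have -> : K * z ^+ 5 = (K * z) * z ^+ 4 by ring.
  have z41 : z ^+ 4 <= 1 by apply: exprn_ile1 => //; exact: ltW.
  have Kz0 : 0 <= K * z by rewrite mulr_ge0//; lra.
  by rewrite -[leRHS]mulr1 ler_pM//; lra.
have h3 : D * (2 * (z ^+ 5 * om) * E0 + E0 ^+ 2) =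
   (D * z) * ((z ^+ 5) ^+ 2 * om ^+ 2 * (K * z ^+ 4) * (2 + K * z ^+ 5)).
  by rewrite /E0; ring.
have h4 : (z ^+ 5) ^+ 2 * om ^+ 2 * (K * z ^+ 4) * (2 + K * z ^+ 5) <=
   (z ^+ 5) ^+ 2 * om ^+ 2 * (K * z ^+ 4) * 3.
  by apply: ler_wpM2l => //; lra.
have h5 : (D * z) * ((z ^+ 5) ^+ 2 * om ^+ 2 * (K * z ^+ 4) * (2 + K * z ^+ 5)) <=
    (z ^+ 5) ^+ 2 * om ^+ 2 * (K * z ^+ 4) * (2 + K * z ^+ 5).
  apply: ler_piMl => //; apply: mulr_ge0 => //.
  have : 0 <= K * z ^+ 5 by rewrite mulr_ge0//; lra.
  lra.
have -> : (z ^+ 5) ^+ 2 * (1 + 3 * (K * z ^+ 4)) * om ^+ 2 =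
  (z ^+ 5 * om) ^+ 2 + (z ^+ 5) ^+ 2 * om ^+ 2 * (K * z ^+ 4) * 3 by ring.
lra.
Qed.

(* The perturbed tensor moves every factor and the core along the tangent
   direction and then renormalizes the factors, so it stays in the model. *)
Lemma tangent_perturbation {R : realType} {m : nat} {d : 'I_m -> nat}
    (core : tensor R (@rank_one m)) (U : forall j, 'M[R]_(d j, rank_one j))
    (I : tensor R d) (kappa : R) :
  let c := core core_index in let H := proj_tangent core U I in
  let eta := kappa / `|c| in
  (forall j, (U j)^T *m U j = 1%:M) -> c != 0 -> 0 < frob H ->
  0 <= kappa -> eta < 1 ->
  exists (c' : R) (x : forall j, 'I_(d j) -> R),
  [/\ forall j, dotv (x j) (x j) = 1,
      forall j i, `|x j i| <= `|colv U j i| + eta,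
      (1 - eta) * `|c| <= `|c'| &
      forall v, `|(rank1 c' x - rank1 c (colv U)) v - kappa / frob H * H v| <=
        `|c| * 4 ^+ m.+1 * eta ^+ 2].
Proof.
move=> c H eta U1 cn0 h0 kappa0 eta1; set h := frob H in h0 *; set u := colv U.
have lam0 : 0 < `|c| by rewrite normr_gt0.
have u1 j : dotv (u j) (u j) = 1 by exact: colv_unit.
have [a [w [HE uw _ HH]]] := tangent_decomp core U I U1.
rewrite -/H -/u -/c in HE uw HH.
have h2 : h ^+ 2 = a ^+ 2 + \sum_j c ^+ 2 * dotv (w j) (w j).
  by rewrite sqr_frob.
pose t := kappa / h.
have th : t * h = kappa by rewrite /t divfK// gt_eqF.
have etal : eta * `|c| = kappa by rewrite /eta divfK// gt_eqF.
have t0 : 0 <= t by rewrite divr_ge0// ltW.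
have eta0 : 0 <= eta by rewrite divr_ge0.
have term_ge0 j : 0 <= c ^+ 2 * dotv (w j) (w j).
  by rewrite mulr_ge0 ?sqr_ge0 ?dotv_ge0.
(* By Pythagoras, neither the core part nor the part of any single mode exceeds the norm [h] of
   [H]. *)
have ta : `|t * a| <= eta * `|c|.
  rewrite etal -th normrM ger0_norm//; apply: ler_wpM2l => //.
  rewrite -(@ler_pXn2r _ 2)// ?nnegrE ?(ltW h0)// real_normK ?num_real// h2.
  by rewrite lerDl sumr_ge0.
have tw j i : `|t * w j i| <= eta.
  rewrite -(ler_pM2r lam0) etal -th normrM ger0_norm// -mulrA.
  apply: ler_wpM2l => //.
  rewrite -(@ler_pXn2r _ 2)// ?nnegrE ?(ltW h0) ?mulr_ge0 ?(ltW lam0)//.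
  rewrite exprMn !real_normK ?num_real// h2 mulrC.
  apply: (@le_trans _ _ (c ^+ 2 * dotv (w j) (w j))).
    by apply: ler_wpM2l; [exact: sqr_ge0|exact: sqr_le_dotv].
  by rewrite (bigD1 j)//= addrCA lerDl addr_ge0 ?sqr_ge0// sumr_ge0.
have etab : 0 <= eta < 1 by rewrite eta0.
have [c' [x [T'E x1 xu cc']]] := curve_rank1 c a t eta u w cn0 etab u1 uw ta tw.
exists c', x; split => // v.
have etab' : 0 <= eta <= 1 by rewrite eta0 ltW.
rewrite HE tensor_subE -T'E.
exact: (curve_remainder c a t eta u w v cn0 etab' u1 ta tw).
Qed.

Lemma sqrt_incoherence {R : realType} (mu mu' dj a b eta : R) :
  0 <= mu -> 0 <= mu' -> 0 < dj -> a <= Num.sqrt (mu / dj) ->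
  b <= a + eta -> eta * Num.sqrt dj <= Num.sqrt mu' - Num.sqrt mu ->
  b <= Num.sqrt (mu' / dj).
Proof.
move=> mu0 mu'0 dj0 aE bE etaE.
have sdj : 0 < Num.sqrt dj by rewrite sqrtr_gt0.
move: aE; rewrite !sqrtrM// !sqrtrV ?(ltW dj0)// ler_pdivlMr// => aE.
rewrite ler_pdivlMr//; apply: le_trans (ler_wpM2r (ltW sdj) bE) _.
by rewrite mulrDl; lra.
Qed.

Lemma small_scale {R : realType} (z K : R) :
  0 < z -> 1 <= K -> 20 * K * z <= 1 ->
  [/\ z <= 1 / 20, 0 <= (z ^+ 5) ^+ 2 * (1 + 3 * (K * z ^+ 4)),
      (z ^+ 5) ^+ 2 * (1 + 3 * (K * z ^+ 4)) <= 2 * z, z ^+ 5 <= 1 / 20 &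
      z ^+ 4 <= z].
Proof.
move=> z0 K1 Kz.
have z1 : z <= 1 / 20 by nra.
have zk k : 0 < z ^+ k by rewrite exprn_gt0.
have zle (i j : nat) : (i <= j)%N -> z ^+ j <= z ^+ i.
  by move=> ij; apply: ler_wiXn2l => //; [exact: ltW|lra].
have k8 : K * z ^+ 4 <= 1 / 3.
  have -> : K * z ^+ 4 = 20 * K * z * (z ^+ 3 / 20) by field.
  apply: (@le_trans _ _ (z ^+ 3 / 20)).
    by apply: ler_piMl => //; rewrite divr_ge0// ltW.
  by have := zle 0%N 3%N isT; rewrite expr0; lra.
have k0 : 0 <= K * z ^+ 4 by apply: mulr_ge0; [lra|exact: ltW].
have zle1 k : z ^+ k.+1 <= z by have := zle 1%N k.+1 isT; rewrite expr1.
split => //.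
- by rewrite -exprM; apply: mulr_ge0; [exact: ltW|lra].
- rewrite -exprM mulrC; apply: ler_pM; [lra|exact: ltW|lra|exact: (zle1 9%N)].
- exact: le_trans z1.
Qed.

(** The threshold [z0] is constrained only by [m], [mu], [mu'] and [C0], so one value serves a whole
    sequence of problems. *)
Lemma finite_sample_efficiency {R : realType} {m : nat} {d : 'I_m -> nat}
    (mu mu' C0 z0 alpha s : R) (n : nat) (T I : tensor R d)
    (core : tensor R (@rank_one m)) (U : forall j, 'M[R]_(d j, rank_one j))
    {disp : measure_display} {Omega : measurableType disp}
    (P : probability Omega R) (X : 'I_n -> Omega -> multi_index d)
    (xi : 'I_n -> {RV P >-> R}) (phi : estimator R d n) :
  0 < mu -> mu < mu' -> 0 < C0 -> (1 < dbar d)%N -> (0 < n)%N -> 0 < s ->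
  0 < alpha -> tucker_model T core U -> incoherent mu U ->
  alpha * Num.sqrt (dbar d)%:R / Num.sqrt (dstar d)%:R * frob I
    <= frob (proj_tangent core U I) ->
  uniform_gaussian_sampling s X xi ->
  admissible_estimator C0 60 mu' s (@rank_one m) X xi T phi ->
  0 < z0 -> 20 * 4 ^+ m.+1 * z0 <= 1 -> z0 <= Num.sqrt mu' - Num.sqrt mu ->
  2 * z0 <= C0 ->
  eps_snr 1 mu alpha n s T I <= 1 -> eps_snr 1 mu alpha n s T I ^+ 2 < z0 ^+ 3 ->
  (((1 - eps_snr 1 mu alpha n s T I ^+ 2) *
    (s ^+ 2 * (dstar d)%:R / n%:R) * frob (proj_tangent core U I) ^+ 2)%:E
   <= mean_squared_error X xi phi T I)%E.
Proof.
move=> mu0 mumu' C00 b1 n0 s0 alpha0 model inc align sampling adm.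
move=> z00 Kz0 z0mu z0C eps1 epsz0.
set H := proj_tangent core U I in align *.
set eps := eps_snr 1 mu alpha n s T I in eps1 epsz0 *.
have mse_ge0 : (0 <= mean_squared_error X xi phi T I)%E.
  by apply: integral_ge0 => o _; rewrite lee_fin sqr_ge0.
have [h0|hn0] := eqVneq (frob H) 0; first by rewrite h0 expr0n mulr0.
set h := frob H in hn0 align *.
have {hn0} h0 : 0 < h by rewrite lt_neqAle eq_sym hn0 frob_ge0.
have [mphi _ adm'] := adm.
have [j0 _] := mode_exists b1.
have U1 j : (U j)^T *m U j = 1%:M by case: model.
pose u := colv U; pose c := core core_index; pose lam := `|c|.
have u1 : forall j, dotv (u j) (u j) = 1 by exact: (model_unit _ _ _ model).
have cn0 : c != 0 by exact: (core_neq0 _ _ _ b1 model).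
have lam0 : 0 < lam by rewrite normr_gt0.
have TE : T = rank1 c u by exact: (modelE _ _ _ model).
pose M := @scale R m d n lam s; pose z := M^-1.
have [DM nM cM bM M2] : [/\ (dstar d)%:R <= M, n%:R <= M, lam <= M * s,
    (dbar d)%:R <= M & 2 <= M].
  exact: (scale_ge s n core b1 s0).
have M0 : 0 < M by exact: lt_le_trans M2.
have zp : 0 < z by rewrite invr_gt0.
pose K : R := 4 ^+ m.+1.
have K1 : 1 <= K by rewrite exprn_ege1// (ler_nat _ 1 4).
have K0 : 0 <= K by exact: le_trans K1.
pose S := Num.max (l1norm I / (alpha * frob I)) 1.
have S1 : 1 <= S by rewrite le_max lexx orbT.
have Sz : S * z ^+ 3 <= eps ^+ 2 by exact: (sqr_eps_scale mu alpha s n T I core U).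
(* Smallness of [eps] becomes largeness of the scale: [z ^ 3 <= S * z ^ 3 <= eps ^ 2 < z0 ^ 3]. *)
have zz0 : z <= z0.
  rewrite -(@ler_pXn2r _ 3)// ?nnegrE; [|exact: ltW|exact: ltW].
  apply/ltW; apply: le_lt_trans epsz0; apply: le_trans Sz.
  by rewrite ler_peMl// exprn_ge0// ltW.
have Kz : 20 * K * z <= 1.
  by apply: le_trans Kz0; apply: ler_wpM2l => //; rewrite mulr_ge0.
have [z1 q0 qz tau1 z4] := small_scale z K zp K1 Kz.
have M4 : 4 <= M.
  rewrite -[M]invrK -/z -[4]invrK lef_pV2 ?posrE ?invr_gt0//.
  by apply: le_trans z1 _; lra.
pose om := Num.sqrt (s ^+ 2 * (dstar d)%:R / n%:R).
have om0 : 0 < om by exact: (omega_gt0 s n T core U).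
have omE : om ^+ 2 = s ^+ 2 * (dstar d)%:R / n%:R by exact: (sqr_omega s n T core U).
have oml : om <= lam by exact: (omega_le mu alpha s n T I core U).
have lom : lam * z ^+ 2 <= om by exact: (core_le_omega s n T core U).
have L1h : l1norm I * z <= S * h by exact: (l1norm_le alpha s n T I core U).
have [_ [_ [_ _ IH _]]] := tangent_decomp core U I U1; rewrite -/H in IH.
have tau0 : 0 <= z ^+ 5 by rewrite exprn_ge0// ltW.
(* The step [t * H] has Frobenius length [z ^ 5 * om], which makes the chi-square distance about
   [z ^ 10]; [eta] is this length relative to the signal. *)
pose t := z ^+ 5 * om / h; pose eta := z ^+ 5 * om / lam.
have th : t * h = z ^+ 5 * om by rewrite /t divfK// gt_eqF.
have t0 : 0 <= t by rewrite divr_ge0 ?mulr_ge0 ?ltW.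
have eta0 : 0 <= eta by rewrite divr_ge0 ?mulr_ge0 ?ltW.
have etaz : eta <= z ^+ 5.
  by rewrite ler_pdivrMr//; apply: ler_wpM2l.
have eta1 : eta <= 1 / 20 by exact: le_trans tau1.
have eta_lt1 : eta < 1 by move: eta1; clear; lra.
have [c' [x [x1 xu cc' rem]]] := tangent_perturbation core U I (z ^+ 5 * om)
  U1 cn0 h0 (mulr_ge0 tau0 (ltW om0)) eta_lt1.
set T' := rank1 c' x in rem.
rewrite -/u -/c -/lam -/H -/h -/t -/eta -/K -TE in rem xu cc'.
set e := lam * K * eta ^+ 2 in rem.
have e0 : 0 <= e by rewrite mulr_ge0 ?sqr_ge0// mulr_ge0// ltW.
have eK : e <= K * (z ^+ 5) ^+ 2 * om.
  have -> : e = K * (z ^+ 5) ^+ 2 * (om * (om / lam)).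
    by rewrite /e /eta; field; rewrite gt_eqF.
  apply: ler_wpM2l; first by rewrite mulr_ge0 ?sqr_ge0.
  by apply: ler_piMr; [exact: ltW|rewrite ler_pdivrMr// mul1r].
have D0 : 0 < (dstar d)%:R :> R by rewrite ltr0n; exact: (dstar_gt0 _ _ _ model).
set q := (z ^+ 5) ^+ 2 * (1 + 3 * (K * z ^+ 4)) in q0 qz.
have devq : inner (T' - T) (T' - T) <= q * om ^+ 2.
  apply: (deviation_numeric z K om (dstar d)%:R e) => //.
  - exact: ltW.
  - by rewrite /z ler_pdivrMr// mul1r.
  - have := sqr_linearization (T' - T) H t e t0 rem.
    by rewrite -/h -exprMn th -[2 * t * h]mulrA th.
have nn : 0 < n%:R :> R by rewrite ltr0n.
have s2 : 0 < s ^+ 2 by rewrite exprn_gt0.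
have sn0 : s != 0 by rewrite gt_eqF.
pose S0 := inner (T' - T) (T' - T) / s ^+ 2.
have S00 : 0 <= S0 by rewrite divr_ge0 ?(ltW s2)// -sqr_frob sqr_ge0.
have nS0 : n%:R * S0 <= q * (dstar d)%:R.
  rewrite /S0 mulrA ler_pdivrMr// mulrC -ler_pdivlMr//.
  by apply: le_trans devq _; rewrite omE le_eqVlt; apply/orP; left; apply/eqP; ring.
have S0q : S0 <= q / z.
  have n1 : 1 <= n%:R :> R by rewrite ler1n.
  rewrite /z invrK; apply: (@le_trans _ _ (n%:R * S0)); first by rewrite ler_peMl.
  by apply: le_trans nS0 _; apply: ler_wpM2l.
have [S0half qhalf chi_num] := chi2_numeric z K S0 q zp K1 Kz erefl S00 S0q.
have chiK : chi2 n s T T' - 1 <= (z ^+ 5) ^+ 2 * (1 + 8 * (K * z ^+ 4)).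
  apply: le_trans chi_num; apply: chi2_le => //.
  - by rewrite -(ltr0n R).
  - by rewrite /S0 divfK// gt_eqF.
have BoptE (A B : tensor R d) : Bopt C0 n s A B <->
    inner (B - A) (B - A) <= C0 * (om ^+ 2 * ((dbar d)%:R * ln (dbar d)%:R)).
  rewrite /Bopt /= sqr_frob omE.
  have -> : s ^+ 2 * (dstar d)%:R * (dbar d)%:R * ln (dbar d)%:R / n%:R =
    s ^+ 2 * (dstar d)%:R / n%:R * ((dbar d)%:R * ln (dbar d)%:R) by ring.
  by [].
have bln : 1 <= (dbar d)%:R * ln (dbar d)%:R :> R by exact: (dbar_ln_ge1 b1).
have BT : Bopt C0 n s T T.
  apply/BoptE; rewrite subrr /inner big1 => [|v _]; last by rewrite ffunE mul0r.
  apply: mulr_ge0; first exact: ltW.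
  by apply: mulr_ge0; [exact: sqr_ge0|exact: le_trans bln].
(* The squared deviation is at most [2 * z * om ^ 2], while the squared radius is at least
   [C0 * om ^ 2] because [dbar * ln dbar >= 1]. *)
have BT' : Bopt C0 n s T T'.
  apply/BoptE; apply: le_trans devq _; apply: ler_pM => //; first exact: sqr_ge0.
    by apply: le_trans qz _; apply: le_trans z0C; apply: ler_wpM2l.
  by rewrite ler_peMr// sqr_ge0.
have mu'0 : 0 < mu' by exact: lt_trans mumu'.
have ub j i : `|u j i| <= Num.sqrt (mu / (d j)%:R) by exact: colv_incoherent.
have dj0 j : 0 < (d j)%:R :> R by rewrite ltr0n; exact: (dim_gt0 _ _ _ model j).
have IT : incoherent_model mu' (@rank_one m) T.
  rewrite TE; apply: incoherent_model_rank1 => // j i; apply: le_trans (ub j i) _.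
  by apply: ler_wsqrtr; rewrite ler_wpM2r ?invr_ge0// ltW.
have c'lam : lam / 2 <= `|c'|.
  apply: le_trans cc'; rewrite mulrC; apply: ler_wpM2r; first exact: ltW.
  by move: eta1; clear; lra.
have c'n0 : c' != 0.
  by rewrite -normr_gt0; apply: lt_le_trans c'lam; rewrite divr_gt0.
have IT' : incoherent_model mu' (@rank_one m) T'.
  apply: incoherent_model_rank1 => // j i.
  apply: (sqrt_incoherence mu mu' (d j)%:R `|u j i| `|x j i| eta) => //; [exact: ltW|exact: ltW|].
  apply: le_trans z0mu; apply: le_trans zz0; apply: le_trans z4.
  have djM : (d j)%:R <= M by apply: le_trans bM; rewrite ler_nat; exact: dim_le_dbar.
  have sM : Num.sqrt (d j)%:R <= M.
    apply: le_trans djM; rewrite -[leRHS]sqr_sqrtr ?ler0n//.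
    rewrite expr2 ler_peMl ?sqrtr_ge0// -[leLHS]sqrtr1; apply: ler_wsqrtr.
    by rewrite ler1n -(ltr0n R).
  (* Incoherence amplifies [eta] by the square root of [d j], at most [M]; this costs one power of
     [z]. *)
  have -> : z ^+ 4 = z ^+ 5 * M by rewrite [z ^+ 5]exprSr -mulrA mulVf ?mulr1// gt_eqF.
  by apply: ler_pM => //; exact: sqrtr_ge0.
have [roT unT] := adm' T IT BT; have [roT' unT'] := adm' T' IT' BT'.
have gap l' A : lambda_max A = l' -> lam / 2 <= l' ->
    rate_optimal C0 60 s X xi phi A ->
    ((1 - z ^+ 30)%:E <= P [set o | Bopt C0 n s A (estimate X xi phi A o)])%E.
  move=> lA ll; apply: le_trans; rewrite lee_fin lerD2l lerN2.
  exact: (mtilde_gap_scale n s lam l' A).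
have gapT : ((1 - z ^+ 30)%:E <= P [set o | Bopt C0 n s T (estimate X xi phi T o)])%E.
  apply: (gap lam) => //; first by rewrite TE (lambda_max_rank1 c u j0).
  by move: lam0; clear; lra.
have gapT' : ((1 - z ^+ 30)%:E <= P [set o | Bopt C0 n s T' (estimate X xi phi T' o)])%E.
  by apply: (gap `|c'|) => //; rewrite (lambda_max_rank1 c' x j0).
(* This [theta] minimises [theta / 2 * V + z ^ 10 / (2 * theta)] at the target value
   [V = (om * h) ^ 2]. *)
have theta0 : 0 < z ^+ 5 / (om * h) by rewrite divr_gt0 ?exprn_gt0// mulr_gt0.
have zp15 : 0 < z ^+ 15 by rewrite exprn_gt0.
have p_r : z ^+ 30 <= (z ^+ 15) ^+ 2 by rewrite -exprM.
have CR := chapman_robbins s X xi sn0 sampling phi T T' I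
  (Bopt C0 n s T) (Bopt C0 n s T') (z ^+ 30) (z ^+ 15) (z ^+ 5 / (om * h)) mphi
  (measurable_Bopt phi C0 s T mphi) (measurable_Bopt phi C0 s T' mphi) unT unT'
  gapT gapT' zp15 p_r theta0.
have [->|mse_fin] := eqVneq (mean_squared_error X xi phi T I) +oo%E.
  by rewrite leey.
have mseE : (mean_squared_error X xi phi T I =
    (fine (mean_squared_error X xi phi T I))%:E)%E.
  by rewrite fineK// ge0_fin_numE// lt_neqAle mse_fin leey.
move: CR; rewrite mseE -EFinM -EFinD !lee_fin => CR.
rewrite -omE -mulrA.
apply: (efficiency_numeric z K om h lam (l1norm I) S e (chi2 n s T T')) => //.
  by apply: sumr_ge0.
apply: le_trans CR; apply: lerB.
  have := inner_linearization (T' - T) H I t e rem.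
  by rewrite innerC IH -sqr_frob -/h expr2 mulrA th.
apply: ler_wpM2r; first by rewrite exprn_ge0// ltW.
by apply: inner_le_l1norm => v; exact: (entry_le_core _ _ _ model v).
Qed.

Theorem theorem1 (R : realType) :
  exists Cgap C : R, 0 < Cgap /\ 0 < C /\
  forall (m : nat) (mu mu' C0 : R)
    (d : nat -> 'I_m -> nat) (n : nat -> nat)
    (sigma alpha : nat -> R)
    (core : forall N, tensor R (@rank_one m))
    (U : forall N (j : 'I_m), 'M[R]_(d N j, rank_one j))
    (T I : forall N, tensor R (d N))
    (disp : nat -> measure_display)
    (Omega : forall N, measurableType (disp N))
    (P : forall N, probability (Omega N) R)
    (X : forall N, 'I_(n N) -> Omega N -> multi_index (d N))
    (xi : forall N, 'I_(n N) -> {RV (P N) >-> R})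
    (phi : forall N, estimator R (d N) (n N)),
  0 < mu -> mu < mu' -> 0 < C0 ->
  (forall N, (1 < dbar (d N))%N) ->
  (forall N, (0 < n N <= dbar (d N) ^ (4 * m))%N) ->
  (forall N, 0 < sigma N) ->
  (forall N, 0 < alpha N) ->
  (forall N, tucker_model (T N) (core N) (U N)) ->
  (forall N, incoherent mu (U N)) ->
  (forall N, alpha N * Num.sqrt (dbar (d N))%:R
               / Num.sqrt (dstar (d N))%:R * frob (I N)
             <= frob (proj_tangent (core N) (U N) (I N))) ->
  (forall N, uniform_gaussian_sampling (sigma N) (X N) (xi N)) ->
  (forall N, admissible_estimator C0 Cgap mu' (sigma N) (@rank_one m) (X N) (xi N)
               (T N) (phi N)) ->
  (fun N => eps_snr C mu (alpha N) (n N) (sigma N) (T N) (I N)) @ \oo --> 0 ->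
  \forall N \near \oo,
    (((1 - eps_snr C mu (alpha N) (n N) (sigma N) (T N) (I N) ^+ 2) *
      ((sigma N) ^+ 2 * (dstar (d N))%:R / (n N)%:R) *
      frob (proj_tangent (core N) (U N) (I N)) ^+ 2)%:E
     <= mean_squared_error (X N) (xi N) (phi N) (T N) (I N))%E.
Proof.
exists 60, 1; split; first by rewrite ltr0n.
split; first exact: ltr01.
move=> m mu mu' C0 d n sigma alpha core U T I disp Omega P X xi phi.
move=> mu0 mumu' C00 b1 n0 sigma0 alpha0 model inc align sampling adm eps0.
pose K : R := 4 ^+ m.+1.
have K0 : 0 < 20 * K by rewrite mulr_gt0// exprn_gt0.
(* The three entries serve the Taylor constant, the incoherence margin and the radius of the
   accuracy ball. *)
pose z := Num.min (20 * K)^-1 (Num.min (Num.sqrt mu' - Num.sqrt mu) (C0 / 2)).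
have z0 : 0 < z.
  rewrite !lt_min invr_gt0 K0 divr_gt0// subr_gt0 ltr_sqrt ?mumu'//.
  exact: lt_trans mumu'.
have zK : z <= (20 * K)^-1 by rewrite ge_min lexx.
have zmu : z <= Num.sqrt mu' - Num.sqrt mu by rewrite !ge_min lexx orbT.
have zC : z <= C0 / 2 by rewrite !ge_min lexx !orbT.
have e0 : 0 < Num.min 1 (z ^+ 3) by rewrite lt_min ltr01 exprn_gt0.
have eps_small := cvgr0_norm_lt _ eps0 _ e0.
near=> N.
have : `|eps_snr 1 mu (alpha N) (n N) (sigma N) (T N) (I N)| < Num.min 1 (z ^+ 3).
  near: N; exact: eps_small.
rewrite lt_min => /andP[eps1 epsz].
have /andP[nN _] := n0 N.
apply: (finite_sample_efficiency mu mu' C0 z) => //.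
- by have := zK; rewrite -(ler_pM2l K0) mulfV// gt_eqF.
- lra.
- exact: le_trans (ler_norm _) (ltW eps1).
- apply: le_lt_trans epsz; rewrite -(real_normK (num_real _)) expr2.
  by rewrite ler_piMl// ltW.
Unshelve. all: by end_near. Qed.
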